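(* Let $G$ be a $\Delta$-critical graph with an edge $xy\in E(G)$, and let $\varphi \in \mathcal{C}^{\Delta}(G-xy)$. Suppose $B = (x, xy, y, yz, z, zv_1, v_1,\ldots, zv_p, v_p)$ is a short broom with respect to $xy$ and $\varphi$. For each color $\alpha\in\{1,\dots,\Delta\}$ define $m_{\varphi,B}(\alpha)=|\{v\in V(B) : \alpha\in\overline{\varphi}(v)\}|-1$ if $\alpha$ is missing at some vertex of $V(B)=\{x,y,z,v_1,\dots,v_p\}$, and $m_{\varphi,B}(\alpha)=0$ otherwise. Then $$\sum_{\alpha \in \{1,\dots,\Delta\}} m_{\varphi, B}(\alpha) \leq 1.$$
   Context: All graphs are finite and simple. $\Delta=\Delta(G)$ is the maximum degree of $G$, and $\chi'(G)$ is the chromatic index (the least $k$ such that $G$ has a proper $k$-edge-coloring). $G$ is $\Delta$-critical if $\chi'(G)=\Delta(G)+1$ and $\chi'(H)<\chi'(G)$ for every proper subgraph $H$ of $G$. $G-xy$ is the graph obtained by deleting the edge $xy$, and $\mathcal{C}^{k}(H)$ is the set of all proper edge colorings of $H$ with colors from $\{1,\dots,k\}$. For $\varphi\in\mathcal{C}^{\Delta}(G-xy)$ and a vertex $v$, $\overline{\varphi}(v)$ is the set of colors in $\{1,\dots,\Delta\}$ not appearing on any edge of $G-xy$ incident with $v$ (the colors missing at $v$); for $X\subseteq V(G)$, $\overline{\varphi}(X)=\bigcup_{v\in X}\overline{\varphi}(v)$. A short broom with respect to $xy$ and $\varphi\in\mathcal{C}^{\Delta}(G-xy)$ is a sequence $B=(x,xy,y,yz,z,zv_1,v_1,zv_2,v_2,\ldots,zv_p,v_p)$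 with $p\ge 1$, consisting of distinct vertices $x,y,z,v_1,\dots,v_p$ and edges $xy,yz,zv_1,\dots,zv_p$ of $G$, such that $\varphi(yz)\in\overline{\varphi}(x)$ and $\varphi(zv_i)\in\overline{\varphi}(\{x,y,z,v_1,\dots,v_{i-1}\})$ for every $i\in\{1,\dots,p\}$. *)

(* Defs.v *)
From mathcomp Require Import all_boot.

Set Implicit Arguments.
Unset Strict Implicit.
Unset Printing Implicit Defensive.

(* A finite simple graph has its vertex set inside an ambient finite type [T],
   so that subgraphs may omit vertices as well as edges.  Edges are unordered
   pairs: two-element sets of vertices.  The well-formedness condition is
   boolean, so two graphs with the same vertices and edges are equal. *)
Record graph (T : finType) := Graph {
  vertices : {set T};
  edges : {set {set T}};
  edges_wf : edges \subset [set e in powerset vertices | #|e| == 2]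
}.

Section Graphs.
Variable T : finType.
Implicit Types (G H : graph T) (e f : {set T}) (x y z u : T) (X : {set T}).

Definition degree G u : nat := #|[set e in edges G | u \in e]|.

Definition max_degree G : nat := \max_(u in vertices G) degree G u.

Definition subgraph H G : bool :=
  (vertices H \subset vertices G) && (edges H \subset edges G).

Definition proper_subgraph H G : Prop := subgraph H G /\ H <> G.

Lemma del_edge_wf G e :
  edges G :\ e \subset [set f in powerset (vertices G) | #|f| == 2].
Proof. exact: subset_trans (subD1set _ _) (edges_wf G). Qed.

Definition del_edge G e : graph T := Graph (del_edge_wf G e).

(* The colors are the elements of ['I_k] (0, ..., k-1 instead of 1, ..., k).
   A coloring is a partial function defined exactly on the edges of [H]; with
   [option], an edgeless graph has a coloring with [k = 0] colors. *)
Definition edge_colorings k H : {set {ffun {set T} -> option 'I_k}} :=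
  [set phi : {ffun {set T} -> option 'I_k} |
    [forall e, isSome (phi e) == (e \in edges H)] &&
    [forall e in edges H, forall f in edges H,
      (e != f) && (e :&: f != set0) ==> (phi e != phi f)]].

Definition edge_colorable H k : bool := edge_colorings k H != set0.

Lemma edge_colorable_ex H : exists k, edge_colorable H k.
Proof.
exists #|{: {set T}}|; apply/set0Pn.
exists [ffun e => if e \in edges H then Some (enum_rank e) else None].
rewrite inE; apply/andP; split.
  by apply/forallP => e; rewrite ffunE; case: ifP.
apply/forall_inP => e eH; apply/forall_inP => f fH.
apply/implyP => /andP[nef _]; rewrite !ffunE eH fH.
by apply: contra nef => /eqP[/enum_rank_inj ->].
Qed.

Definition chromatic_index H : nat := ex_minn (edge_colorable_ex H).

Definition critical G : Prop :=
  chromatic_index G = (max_degree G).+1 /\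
  forall H, proper_subgraph H G -> chromatic_index H < chromatic_index G.

Section Missing.
Variables (k : nat) (H : graph T) (phi : {ffun {set T} -> option 'I_k}).

Definition missing u : {set 'I_k} :=
  [set a | [forall e in edges H, (u \in e) ==> (phi e != Some a)]].

Definition missing_in X : {set 'I_k} := \bigcup_(u in X) missing u.

End Missing.

Definition broom_vertices x y z (v : seq T) : {set T} :=
  [set u in [:: x, y, z & v]].

(* [v] lists v_1, ..., v_p, indexed from 0; since the graph is simple, the
   vertices determine the edges of the broom. *)
Record short_broom k G x y (phi : {ffun {set T} -> option 'I_k}) z
    (v : seq T) : Prop := ShortBroom {
  broom_size : 0 < size v;
  broom_uniq : uniq [:: x, y, z & v];
  broom_xy : [set x; y] \in edges G;
  broom_yz : [set y; z] \in edges G;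
  broom_zv : forall u, u \in v -> [set z; u] \in edges G;
  broom_color_yz : exists2 a, phi [set y; z] = Some a
    & a \in missing (del_edge G [set x; y]) phi x;
  broom_color_zv : forall i, i < size v ->
    exists2 a, phi [set z; nth x v i] = Some a
    & a \in missing_in (del_edge G [set x; y]) phi
              (broom_vertices x y z (take i v))
}.

Definition excess k H (phi : {ffun {set T} -> option 'I_k}) X (a : 'I_k) :
    nat :=
  if a \in missing_in H phi X
  then #|[set u in X | a \in missing H phi u]| - 1 else 0.

End Graphs.

(* Main.v *)
(** Let t be a color missing at y, and let d, the color of yz, be missing at x.
    For a color c missing at x or y, the branch of c consists of the vertices
    that are reached at z starting from the edge colored c. After moving the
    uncolored edge to yz, the branches of the colors of y form a Vizing fan at
    z. Let s <> d be missing at x. If the (s, t)-chain from x to y passes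
    through z, then recoloring its part between x and z and uncoloring an edge
    at z turns the branches of s and t into a single Vizing fan; otherwise
    exchanging s and t on this chain makes either branch a fan of the first
    kind, without affecting the chains of the other colors. Either way no color
    is missing at two vertices of these two branches. Hence a color repeated
    away from x and y is repeated between the branches of two colors of x. Given
    a second repetition, Kempe changes at such vertices produce one vertex
    missing d and another missing t, both still reachable, and moving the
    uncolored edge back to xy then yields a coloring of the whole graph with
    Delta colors. *)
Require Import Defs.
From mathcomp Require Import all_boot.

Set Implicit Arguments.
Unset Strict Implicit.
Unset Printing Implicit Defensive.

(** * Chains in graphs of maximum degree two *)

Section Connect.
Variables (T : finType) (e : rel T).

Lemma connect_inv (P : T -> Prop) a b :
  (forall u v, P u -> e u v -> P v) -> connect e a b -> P a -> P b.
Proof.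
move=> stepP /connectP[p pth ->]; elim: p a pth => [|v p IHp] a //=.
by case/andP=> eav pth Pa; apply: IHp pth _; apply: stepP eav.
Qed.

Definition is_end u := forall v w, e u v -> e u w -> v = w.

Hypothesis e_sym : symmetric e.
Hypothesis e_deg2 : forall u v1 v2 v3, e u v1 -> e u v2 -> e u v3 ->
  [\/ v1 = v2, v1 = v3 | v2 = v3].

(** Inner vertices of the path already have two neighbors on it and its ends have one, so no edge
    leaves it: the path is a whole component. *)
Lemma path_between_ends_closed a p : path e a p -> uniq (a :: p) ->
  a != last a p -> is_end a -> is_end (last a p) ->
  forall u v, u \in a :: p -> e u v -> v \in a :: p.
Proof.
move=> pth upth nal enda endl u v; rewrite inE => /orP[/eqP-> eav|].
  case: p pth {upth endl} nal => [|b p] /=; first by rewrite eqxx.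
  case/andP=> eab _ _; rewrite (enda _ _ eav eab).
  by rewrite !inE eqxx orbT.
move=> up euv; case/splitPr: p / up pth upth nal endl => p1 p2.
rewrite cat_path /= last_cat => /and3P[_ eu pth2] upth nal endl.
rewrite e_sym in eu; set b := last a p1 in eu *.
have b_in : b \in a :: p1 ++ u :: p2.
  by rewrite -cat_cons mem_cat mem_last.
case: p2 pth2 upth nal endl b_in => [|c p2] /=.
  by move=> _ _ _ endl b_in; rewrite (endl _ _ euv eu).
case/andP=> euc _ /andP[na]; rewrite cat_uniq => /and3P[_ dis _] _ _ b_in.
(* Here [b] and [c] are the neighbors of [u] on the path; [b = c] would contradict its
   simplicity. *)
have [->|->|bc] := e_deg2 euv eu euc => //.
  by rewrite inE mem_cat !inE eqxx !orbT.
have := mem_last a p1; rewrite -/b bc inE => /orP[/eqP ca|cp1].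
  by move: na; rewrite mem_cat !inE ca eqxx !orbT.
by case/negP: dis; apply/hasP; exists c; rewrite ?inE ?eqxx ?orbT.
Qed.

(** The path from [a] to [b] is closed, so [c] is an inner vertex of it and has two distinct
    neighbors, although it is an end. *)
Lemma three_ends a b c : a != b -> a != c -> b != c ->
  is_end a -> is_end b -> is_end c -> connect e a b -> connect e a c -> False.
Proof.
move=> nab nac nbc enda endb endc /connectP[p0 pth0 lb] eac.
case/shortenP: pth0 lb => p pth upth _ lb.
have cl := @path_between_ends_closed a p pth upth.
rewrite -lb in cl; move/(_ nab enda endb) in cl.
have: c \in a :: p.
  by apply: (connect_inv (P := fun u => u \in a :: p)) eac _;
    [move=> u v /cl; apply | rewrite mem_head].
rewrite inE eq_sym (negPf nac) /= => cp.
case/splitPr: p / cp pth upth lb {cl} => p1 p2.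
rewrite cat_path last_cat /= => /and3P[_ ec pth2] upth lb.
case: p2 pth2 upth lb => [|d p2] /=; first by move=> _ _ bc; rewrite bc eqxx in nbc.
case/andP=> ecd _ /andP[na]; rewrite cat_uniq => /and3P[_ dis _] _.
rewrite e_sym in ec; have ld := endc _ _ ec ecd.
have := mem_last a p1; rewrite ld inE => /orP[/eqP da|dp1].
  by move: na; rewrite mem_cat !inE da eqxx !orbT.
by case/negP: dis; apply/hasP; exists d; rewrite ?inE ?eqxx ?orbT.
Qed.

End Connect.

(** * Kempe changes *)

Section Kempe.
Variables (T C : finType).
Implicit Types (f : T -> T -> option C) (u v w : T) (c : C) (Q : {set T}).

(* A coloring is a symmetric partial function on pairs of vertices. It may also
   color pairs that are not edges of the graph g introduced below: coloring
   more pairs only strengthens properness. *)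
Record proper f : Prop := Proper {
  col_sym : forall u v, f u v = f v u;
  col_irr : forall u, f u u = None;
  col_inj : forall u v w c, f u v = Some c -> f u w = Some c -> v = w }.

Definition miss f u c : bool := [forall v, f u v != Some c].

Lemma missP f u c : reflect (forall v, f u v <> Some c) (miss f u c).
Proof. by apply: (iffP forallP) => h v; apply/eqP; apply: h. Qed.

Lemma missE f u v c : miss f u c -> f u v = Some c -> False.
Proof. by move/missP=> m /m. Qed.

Lemma missPn f u c : reflect (exists v, f u v = Some c) (~~ miss f u c).
Proof.
rewrite negb_forall; apply: (iffP existsP) => -[v]; last by exists v; apply/negPn/eqP.
by move/negPn/eqP; exists v.
Qed.

Definition same_pair a b u v := ((u == a) && (v == b)) || ((u == b) && (v == a)).

Lemma same_pairC a b u v : same_pair a b v u = same_pair a b u v.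
Proof. by rewrite /same_pair orbC andbC [(v == a) && _]andbC. Qed.

Lemma same_pairCl a b u v : same_pair b a u v = same_pair a b u v.
Proof. by rewrite /same_pair orbC. Qed.

Definition upd f a b o : T -> T -> option C :=
  fun u v => if same_pair a b u v then o else f u v.

Lemma upd_proper_None f a b : proper f -> proper (upd f a b None).
Proof.
move=> [fs fi fj]; split=> [u v|u|u v w c]; rewrite /upd.
- by rewrite same_pairC fs.
- by case: ifP.
- by do 2!case: ifP => // _; apply: fj.
Qed.

Lemma upd_proper_Some f a b c : proper f -> a != b -> miss f a c -> miss f b c ->
  proper (upd f a b (Some c)).
Proof.
move=> [fs fi fj] nab /missP ma /missP mb; split=> [u v|u|u v w d]; rewrite /upd.
- by rewrite same_pairC fs.
- case: ifP => // /orP[]/andP[/eqP-> /eqP ab]; first by rewrite ab eqxx in nab.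
  by rewrite ab eqxx in nab.
- case: ifP => [p1|_]; case: ifP => [p2|_]; last exact: fj.
  + move=> _ _; case/orP: p1 => /andP[/eqP u1 /eqP->];
      case/orP: p2 => /andP[/eqP u2 /eqP->] //;
      by move: nab; rewrite -u1 -u2 eqxx.
  + move=> [<-] fd; case/orP: p1 => /andP[/eqP u_ _]; rewrite u_ in fd.
      by case: (ma _ fd).
    by case: (mb _ fd).
  + move=> fd [cd]; rewrite -{}cd in fd; case/orP: p2 => /andP[/eqP u_ _]; rewrite u_ in fd.
      by case: (ma _ fd).
    by case: (mb _ fd).
Qed.

Definition sw (a b c : C) : C := if c == a then b else if c == b then a else c.

Lemma swK a b : involutive (sw a b).
Proof.
move=> c; rewrite /sw; have [->|nca] := eqVneq c a.
  by have [->|nba] := eqVneq b a; rewrite ?eqxx.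
have [->|ncb] := eqVneq c b; first by rewrite eqxx.
by rewrite (negPf nca) (negPf ncb).
Qed.

Lemma sw_id a b c : c != a -> c != b -> sw a b c = c.
Proof. by rewrite /sw => /negPf-> /negPf->. Qed.

Lemma sw_l a b : sw a b a = b. Proof. by rewrite /sw eqxx. Qed.
Lemma sw_r a b : sw a b b = a.
Proof. by rewrite /sw; case: eqVneq => [->|_]; rewrite ?eqxx. Qed.

(* Testing u alone suffices: Q is always a union of (a, b)-chains. *)
Definition kem f a b Q : T -> T -> option C :=
  fun u v => if u \in Q then omap (sw a b) (f u v) else f u v.

Definition ab f (a b : C) : rel T := [rel u v | (f u v == Some a) || (f u v == Some b)].

Definition link f a b u v := connect (ab f a b) u v.

Definition chain f a b u : {set T} := [set v | link f a b u v].

Definition closed_in f a b Q := forall u v, u \in Q -> ab f a b u v -> v \in Q.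

Lemma ab_sym f a b : proper f -> symmetric (ab f a b).
Proof. by move=> pf u v; rewrite /ab /= (col_sym pf u v). Qed.

Lemma link_sym f a b u v : proper f -> link f a b u v = link f a b v u.
Proof. by move=> pf; rewrite /link (sym_connect_sym (ab_sym _ _ pf)). Qed.

Lemma chain_closed f a b u : closed_in f a b (chain f a b u).
Proof. by move=> v w; rewrite !inE => uv vw; apply: connect_trans uv (connect1 vw). Qed.

Lemma mem_chain f a b u : u \in chain f a b u.
Proof. by rewrite inE /link connect0. Qed.

Definition endp f a b u := miss f u a || miss f u b.

Lemma endp_is_end f a b u : proper f -> endp f a b u -> is_end (ab f a b) u.
Proof.
move=> pf; rewrite /endp => /orP[]/missP m v w /orP[]/eqP f1 /orP[]/eqP f2;
  by [case: (m _ f1) | case: (m _ f2) | apply: col_inj f1 f2].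
Qed.

(** A chain has at most two ends; many contradictions below exhibit a third one. *)
Lemma ends3 f a b u v w : proper f -> u != v -> u != w -> v != w ->
  endp f a b u -> endp f a b v -> endp f a b w ->
  link f a b u v -> link f a b u w -> False.
Proof.
move=> pf nuv nuw nvw eu ev ew luv luw.
apply: (@three_ends T (ab f a b) (ab_sym _ _ pf) _ u v w) => //;
  try exact: endp_is_end.
move=> x v1 v2 v3 /orP[]/eqP f1 /orP[]/eqP f2 /orP[]/eqP f3;
  by [constructor 1; apply: col_inj f1 f2 | constructor 2; apply: col_inj f1 f3
     |constructor 3; apply: col_inj f2 f3].
Qed.

Lemma kem_proper f a b Q : proper f -> closed_in f a b Q -> proper (kem f a b Q).
Proof.
move=> pf cl; split=> [u v|u|u v w c].
- rewrite /kem; have fs := col_sym pf u v.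
  case uQ: (u \in Q); case vQ: (v \in Q) => //; rewrite ?fs //.
    case fvu: (f v u) => [c|] //=; congr Some; apply: sw_id;
      apply: contraFneq vQ => ca;
      by apply: cl uQ _; rewrite /ab /= fs fvu ca eqxx ?orbT.
  case fvu: (f v u) => [c|] //=; congr Some; symmetry; apply: sw_id;
    apply: contraFneq uQ => ca;
    by apply: cl vQ _; rewrite /ab /= fvu ca eqxx ?orbT.
- by rewrite /kem col_irr //; case: ifP.
- rewrite /kem; case: ifP => _; last exact: col_inj.
  case f1: (f u v) => [c1|] //= [e1]; case f2: (f u w) => [c2|] //= [e2].
  have c12 : c1 = c2 by apply: (can_inj (swK a b)); rewrite e1 e2.
  by rewrite -c12 in f2; apply: col_inj f1 f2.
Qed.

Lemma miss_kem f a b Q u c :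
  miss (kem f a b Q) u c = miss f u (if u \in Q then sw a b c else c).
Proof.
rewrite /miss /kem; apply: eq_forallb => v; case: ifP => // _.
case: (f u v) => //= d; congr negb.
by apply/eqP/eqP => -[]; [move=> <- | move=> ->]; rewrite swK.
Qed.

Lemma kem_None f a b Q u v : (kem f a b Q u v == None) = (f u v == None).
Proof. by rewrite /kem; case: ifP => //; case: (f u v). Qed.

Lemma kem_other f a b Q u v c : c != a -> c != b ->
  (kem f a b Q u v == Some c) = (f u v == Some c).
Proof.
move=> ca cb; rewrite /kem; case: ifP => // _; case: (f u v) => //= d.
apply/eqP/eqP => -[] => [dc|->]; last by rewrite sw_id.
by congr Some; apply: (can_inj (swK a b)); rewrite dc sw_id.
Qed.

Lemma endpl f a b u : miss f u a -> endp f a b u.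
Proof. by rewrite /endp => ->. Qed.

Lemma endpr f a b u : miss f u b -> endp f a b u.
Proof. by rewrite /endp => ->; rewrite orbT. Qed.

(** * Vizing fans *)

(** Sources range over [belast a p], so what is missing at the last vertex may change freely. *)
Lemma path_sub (e e' : rel T) a p : path e a p ->
  (forall u v, u \in belast a p -> v \in p -> e u v -> e' u v) -> path e' a p.
Proof.
elim: p a => //= v p IHp a /andP[eav pth] sub; apply/andP; split.
  by apply: sub eav; rewrite mem_head.
by apply: IHp => // u w up wp; apply: sub; rewrite inE ?up ?wp orbT.
Qed.

(** A simple path in this relation is a Vizing fan at [z]; [connect (arr f z) w u] places [u] on a
    fan starting at [w]. *)
Definition arr f z : rel T :=
  [rel u v | [exists c, miss f u c && (f z v == Some c)]].

Lemma arrP f z u v : reflect (exists2 c, miss f u c & f z v = Some c) (arr f z u v).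
Proof.
apply: (iffP existsP) => [[c /andP[mc /eqP fc]]|[c mc fc]]; exists c => //.
by rewrite mc fc eqxx.
Qed.

Variable g : rel T.

(** The pair [a], [b] is the only possible hole; under [uncolorable] it is indeed uncolored, see
    [partial_None]. *)
Definition partial f a b : Prop :=
  [/\ proper f, a != b & forall u v, g u v -> f u v = None -> same_pair a b u v].

Hypothesis uncolorable :
  forall f, proper f -> exists2 e : T * T, g e.1 e.2 & f e.1 e.2 = None.

Lemma close_hole f a b c : partial f a b -> miss f a c -> miss f b c -> False.
Proof.
move=> [pf nab hf] ma mb.
have [[u v] /= guv] := uncolorable (upd_proper_Some pf nab ma mb).
by rewrite /upd; case: ifP => // np /(hf _ _ guv); rewrite np.
Qed.

Lemma kem_partial f a b Q u v : partial f u v -> closed_in f a b Q ->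
  partial (kem f a b Q) u v.
Proof.
move=> [pf nuv hf] cl; split=> //; first exact: kem_proper.
by move=> u' v' guv /eqP; rewrite kem_None => /eqP/hf; apply.
Qed.

Lemma miss_updN f a b u c : miss f u c -> miss (upd f a b None) u c.
Proof. by move/missP=> m; apply/missP=> v; rewrite /upd; case: ifP. Qed.

Lemma miss_upd_out f a b o u c : u != a -> u != b ->
  miss (upd f a b o) u c = miss f u c.
Proof.
move=> /negPf ua /negPf ub; rewrite /miss; apply: eq_forallb => v.
by rewrite /upd /same_pair ua ub.
Qed.

Lemma fan_neq f z w u : proper f -> z != w -> connect (arr f z) w u -> u != z.
Proof.
move=> pf zw cu; apply: (connect_inv (P := fun u => u != z) _ cu); last by rewrite eq_sym.
move=> u1 v _ /arrP[c _]; apply: contra_eqT => /negbNE/eqP ->.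
by rewrite col_irr.
Qed.

(** Vizing's shift: each fan edge takes the color of the next one and the hole moves to the last
    edge. The last vertex gains the color of its former edge, unless it is [w] and nothing moves. *)
Lemma fan_shift f z w p : partial f z w -> path (arr f z) w p -> uniq (w :: p) ->
  exists f',
   [/\ partial f' z (last w p),
       forall c, miss f z c -> miss f' z c,
       forall u v, u != z -> v != z -> f' u v = f u v,
       forall u c, u \notin w :: p -> u != z -> miss f u c -> miss f' u c
     & (forall c, miss f (last w p) c -> miss f' (last w p) c) /\
       (forall c, last w p != w -> f z (last w p) = Some c -> miss f' (last w p) c)].
Proof.
elim: p f w => [|u p IHp] f w.
  by move=> pfw _ _; exists f; split=> //; split=> // c; rewrite eqxx.
move=> [pf nzw hf] /= /andP[/arrP[c mwc fzu] pth] /andP[w_up /andP[u_p up]].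
have nzu : z != u by apply: contra_eqT fzu => /negbNE/eqP <-; rewrite col_irr.
have nwu : w != u by apply: contraNneq w_up => ->; rewrite mem_head.
pose f0 := upd f z u None; pose f1 := upd f0 z w (Some c).
have f0z : miss f0 z c.
  apply/missP=> v; rewrite /f0 /upd; case: ifP => // np fzv.
  by rewrite (col_inj pf fzv fzu) /same_pair !eqxx in np.
have f1p : proper f1.
  by apply: upd_proper_Some => //; [exact: upd_proper_None|exact: miss_updN].
have f1h : partial f1 z u.
  split=> // a b gab; rewrite /f1 /upd; case: ifP => // np; rewrite /f0 /upd.
  by case: ifP => // _ /(hf _ _ gab); rewrite np.
have f1m v d : v != w -> v != z -> miss f v d -> miss f1 v d.
  by move=> vw vz md; rewrite miss_upd_out //; apply: miss_updN.
have f1z d : miss f z d -> miss f1 z d.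
  move=> /missP md; apply/missP=> v; rewrite /f1 /f0 /upd.
  case: ifP => _; first by move=> [cd]; apply: (md u); rewrite fzu cd.
  by case: ifP => // _; apply: md.
have f1u : miss f1 u c.
  rewrite miss_upd_out 1?eq_sym //; apply/missP=> v; rewrite /f0 /upd.
  case: ifP => // np fuv; rewrite (col_sym pf) in fzu.
  by rewrite (col_inj pf fuv fzu) /same_pair !eqxx orbT in np.
have f1s v : v != w -> v != u -> f1 z v = f z v.
  by move=> /negPf vw /negPf vu; rewrite /f1 /f0 /upd /same_pair vw vu !andbF (negPf nzu) (negPf nzw).
(* Since [w :: u :: p] has no repetition, the first shift does not disturb the arrows of the
   remaining fan. *)
have p1 : path (arr f1 z) u p.
  apply: (path_sub pth) => a b ua bp /arrP[d ad zb]; apply/arrP; exists d.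
    apply: f1m => //; last first.
      have: a \in u :: p by apply: mem_belast.
      rewrite inE => /orP[/eqP->|ap]; first by rewrite eq_sym.
      have := pth; case/splitPr: p / ap {IHp w_up u_p up pth ua bp} => q1 q2.
      rewrite cat_path /= => /and3P[_ /arrP[d' _ fa] _].
      by apply: contra_eqT fa => /negbNE/eqP ->; rewrite col_irr.
    by apply: contraNneq w_up => <-; apply: mem_belast.
  rewrite f1s //; last by apply: contraNneq u_p => <-.
  by apply: contraNneq w_up => <-; rewrite inE bp orbT.
have [] := IHp f1 u f1h p1; first by rewrite /= u_p.
move=> f' [h1 h2 h3 h4 [h5 h6]]; exists f'; split=> //.
- by move=> d /f1z/h2.
- move=> a b az bz; rewrite h3 // /f1 /f0 /upd /same_pair (negPf az) (negPf bz).
  by rewrite !andbF.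
- move=> a d; rewrite inE negb_or => /andP[aw aup] az md.
  by apply: h4 => //; apply: f1m.
have lw : last u p != w by apply: contraNneq w_up => <-; apply: mem_last.
have lz : last u p != z.
  by case: h1 => _; rewrite eq_sym.
split=> d; first by move=> md; apply: h5; apply: f1m.
move=> _ fl; have [lu|lu] := eqVneq (last u p) u.
  by rewrite lu in fl *; move: fl; rewrite fzu => -[<-]; rewrite -{1}lu; apply: h5; rewrite lu.
by apply: h6; rewrite // f1s.
Qed.

(** Shifting the hole to [zu] would leave it with a color missing at both ends. *)
Lemma fan_disjoint f z w u a : partial f z w -> connect (arr f z) w u ->
  miss f z a -> miss f u a -> False.
Proof.
move=> pf /connectP[p0 p0P ->]; case/shortenP: p0P => p pth up _ mz mu.
have [f' [h1 h2 _ _ [h5 _]]] := fan_shift pf pth up.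
exact: close_hole h1 (h2 _ mz) (h5 _ mu).
Qed.

(** Otherwise exchanging [a] and [b] on the chain of [u] makes [u] miss [a] like [z], against
    [fan_disjoint]. The fan survives the exchange: by induction on its length, earlier vertices
    missing [b] lie on the chain of [z]. *)
Lemma fan_link f z w u a b : partial f z w -> connect (arr f z) w u ->
  miss f z a -> miss f u b -> link f a b z u.
Proof.
move=> pfw; have [pf nzw _] := pfw.
move=> /connectP[p0 p0P ->] mz; case/shortenP: p0P => p pth up _ {p0}.
have [n] := ubnP (size p); elim: n => // n IHn in p pth up *.
rewrite ltnS => szp mu; apply/negPn/negP => nl.
pose Q := chain f a b (last w p).
have zQ : z \notin Q by rewrite inE link_sym.
have Qb v : v \in belast w p -> miss f v b -> v \notin Q.
  move=> vp mv; have vw : v \in w :: p by apply: mem_belast.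
  have vl : v != last w p.
    by apply: contraTneq up => vl; rewrite lastI rcons_uniq -vl vp.
  case/splitPl: p / vw => p1 p2 lp1 in pth up szp mu nl Q zQ vp vl *.
  move: pth up szp; rewrite cat_path -cat_cons cat_uniq size_cat.
  move=> /andP[pth _] /andP[up _] szp.
  have np2 : 0 < size p2.
    by case: (p2) vl => //; rewrite cats0 lp1 eqxx.
  have lz : link f a b z v.
    rewrite -lp1; apply: IHn => //; last by rewrite lp1.
    by apply: leq_trans szp; rewrite -addn1 leq_add2l.
  apply: contra nl; rewrite inE => lv; apply: connect_trans lz _.
  by rewrite -/(link f a b v _) link_sym.
have pf' := kem_partial pfw (@chain_closed f a b (last w p)).
apply: (@fan_disjoint (kem f a b Q) z w (last w p) a) => //.
- apply/connectP; exists p => //; apply: (path_sub pth) => v v' vp _ /arrP[c vc zv'].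
  apply/arrP; exists c; last by rewrite /kem (negPf zQ).
  rewrite miss_kem; case: ifP => // vQ; rewrite sw_id //.
    by apply: contraTneq mz => ca; apply/missPn; exists v'; rewrite zv' ca.
  by apply: contraTneq vQ => cb; apply: Qb => //; rewrite -cb.
- by rewrite miss_kem (negPf zQ).
by rewrite miss_kem mem_chain sw_l.
Qed.

(** The chain of [z] would have the three ends [z], [u], [v]. *)
Lemma fan_elementary f z w u v a b : partial f z w ->
  connect (arr f z) w u -> connect (arr f z) w v -> u != v ->
  miss f z a -> miss f u b -> miss f v b -> False.
Proof.
move=> pfw cu cv nuv mz mu mv; have [pf nzw _] := pfw.
have zu : z != u by rewrite eq_sym (fan_neq pf nzw cu).
have zv : z != v by rewrite eq_sym (fan_neq pf nzw cv).
exact: (ends3 pf zu zv nuv (endpl b mz) (endpr a mu) (endpr a mv)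
  (fan_link pfw cu mz mu) (fan_link pfw cv mz mv)).
Qed.

(** No arrow uses [a], which is missing at [z], and sources missing [b] lie outside [Q]; hence every
    arrow survives. *)
Lemma kem_fan f z w u a b Q : partial f z w -> z \notin Q -> miss f z a ->
  (forall v, connect (arr f z) w v -> miss f v b -> v \notin Q) ->
  connect (arr f z) w u -> connect (arr (kem f a b Q) z) w u.
Proof.
move=> pfw zQ mz Qb cu.
pose P v := connect (arr f z) w v /\ connect (arr (kem f a b Q) z) w v.
suff: P u by case.
apply: (connect_inv (P := P) _ cu); last by rewrite /P !connect0.
move=> v v' [cv cv'] vv'; split; first exact: connect_trans cv (connect1 vv').
apply: connect_trans cv' (connect1 _); case/arrP: vv' => c vc zv'.
apply/arrP; exists c; last by rewrite /kem (negPf zQ).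
rewrite miss_kem; case: ifP => // vQ; rewrite sw_id //.
  by apply: contraTneq mz => ca; apply/missPn; exists v'; rewrite zv' ca.
by apply: contraTneq vQ => cb; apply: Qb => //; rewrite -cb.
Qed.

(** Otherwise an exchange on the chain of [x] makes both ends of the hole miss [b]. *)
Lemma hole_link f x y a b : partial f x y -> miss f x a -> miss f y b ->
  link f a b x y.
Proof.
move=> pf ma mb; apply/negPn/negP => nl.
have pf' := kem_partial pf (@chain_closed f a b x).
apply: (close_hole pf' (c := b)); first by rewrite miss_kem mem_chain sw_r.
by rewrite miss_kem inE (negPf nl).
Qed.

(** * Branches of a broom *)

Variables (x y z : T) (d : C).

(** A Kierstead path [x], [y], [z] with hole [xy]. *)
Definition kstate f := [/\ partial f x y, f y z = Some d, miss f x d & z != x].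

(* The vertices v reached through the edges zv, starting from the edge colored
   c; for c missing at x or y these are vertices of a broom. *)
Inductive branch f c : T -> Prop :=
| branch_root r : f z r = Some c -> r != x -> r != y -> branch f c r
| branch_step u v e : branch f c u -> miss f u e -> f z v = Some e ->
    v != x -> v != y -> branch f c v.

(** A maximal broom in closure form; [z] is left out, since a color missing at [z] is on no edge at
    [z]. *)
Inductive reach f : T -> Prop :=
| reach_x : reach f x
| reach_y : reach f y
| reach_step u v e : reach f u -> miss f u e -> f z v = Some e -> reach f v.

Lemma branch_neq f c u : kstate f -> branch f c u -> [/\ u != x, u != y & u != z].
Proof.
move=> [[pf _ _] _ _ _] b; have fzz v e : f z v = Some e -> v != z.
  by move=> fzv; apply: contra_eqT fzv => /negbNE/eqP ->; rewrite col_irr.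
by case: b => [r fr rx ry|u' v e _ _ fv vx vy]; split=> //; apply: fzz; eassumption.
Qed.

Lemma kstate_zy f : kstate f -> z != y.
Proof.
move=> [[pf _ _] fyz _ _]; apply: contra_eqT fyz => /negbNE/eqP ->.
by rewrite col_irr.
Qed.

Lemma kstate_zyd f : kstate f -> f z y = Some d.
Proof. by move=> [[pf _ _] fyz _ _]; rewrite (col_sym pf). Qed.

Lemma kstate_disj f c : kstate f -> miss f x c -> miss f y c -> False.
Proof. by move=> [pf _ _ _]; apply: close_hole. Qed.

Lemma kstate_link f a b : kstate f -> miss f x a -> miss f y b -> link f a b x y.
Proof. by move=> [pf _ _ _]; apply: hole_link pf. Qed.

(** The branch is fixed by the last departure from [x] or [y]. *)
Lemma reach_branch f u : kstate f -> reach f u ->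
  [\/ u = x, u = y | exists2 c, miss f x c \/ miss f y c & branch f c u].
Proof.
move=> kf; elim=> [||{}u v e _ IHu mu fzv]; [by constructor 1|by constructor 2|].
have [->|vx] := eqVneq v x; first by constructor 1.
have [->|vy] := eqVneq v y; first by constructor 2.
constructor 3; case: IHu mu => [->|->|[c mc bu]] mu.
- by exists e; [left|apply: branch_root].
- by exists e; [right|apply: branch_root].
by exists c => //; apply: branch_step mu fzv _ _.
Qed.

Lemma branch_reach f c u : miss f x c \/ miss f y c -> branch f c u -> reach f u.
Proof.
move=> mc; elim=> [r fr _ _|{}u v e _ ru mu fv _ _]; last exact: reach_step mu fv.
by case: mc => mc; [apply: reach_step (reach_x f) mc fr|apply: reach_step (reach_y f) mc fr].
Qed.

(** Common to both ways of turning branches into fans. The color of [zw] may change because [w]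
    starts the fan, that of [zy] because branches avoid [y]. *)
Lemma branch_sub_fan f h w c u : kstate f ->
  (forall v, v != y -> v != w -> h z v = f z v) ->
  (forall v e, v != x -> v != y -> miss f v e -> miss h v e) ->
  (forall r, f z r = Some c -> r != x -> r != y -> connect (arr h z) w r) ->
  branch f c u -> connect (arr h z) w u.
Proof.
move=> kf hz hm hr bu; have : branch f c u by [].
elim: bu => [r fr rx ry _|{}u v e bu IHu mu fzv vx vy _]; first exact: hr.
have [ux uy _] := branch_neq kf bu.
have [->|vw] := eqVneq v w; first exact: connect0.
apply: connect_trans (IHu bu) (connect1 _); apply/arrP; exists e; first exact: hm.
by rewrite hz.
Qed.

(* The hole moves to yz; the branches of the colors of y then form a Vizing fan
   at z starting from y. *)
Definition hub f := upd (upd f y z None) x y (Some d).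

(** * Fans after the hole moves to [yz] *)

Section Hub.
Variable f : T -> T -> option C.
Hypothesis kf : kstate f.

Lemma hub_partial : partial (hub f) z y.
Proof.
have [[pf xy hf] fyz mx zx] := kf; have zy := kstate_zy kf.
split=> //; last first.
  move=> u v guv; rewrite /hub /upd; case: ifP => // np.
  case: ifP => [yzp _|_ /(hf _ _ guv)]; last by rewrite np.
  by rewrite same_pairCl.
apply: upd_proper_Some => //; first exact: upd_proper_None.
  exact: miss_updN.
apply/missP=> v; rewrite /upd; case: ifP => // np fyv.
by rewrite (col_inj pf fyv fyz) /same_pair !eqxx in np.
Qed.

Lemma hub_miss u c : u != x -> miss f u c -> miss (hub f) u c.
Proof.
move=> ux mu; have [[pf xy hf] fyz mx zx] := kf.
have [uy|uy] := eqVneq u y; last by rewrite miss_upd_out //; apply: miss_updN.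
subst u; apply/missP=> v; rewrite /hub /upd; case: ifP => [_ [dc]|_].
  by move/missP: mu => /(_ z); rewrite fyz dc.
by case: ifP => // _; move/missP: mu; apply.
Qed.

Lemma hub_missz : miss (hub f) z d.
Proof.
have [[pf xy hf] fyz mx zx] := kf; have zy := kstate_zy kf.
rewrite miss_upd_out //; apply/missP=> v; rewrite /upd; case: ifP => // np.
rewrite -(kstate_zyd kf) => /esym fzv; rewrite (kstate_zyd kf) in fzv.
by rewrite (col_inj pf (esym fzv) (kstate_zyd kf)) /same_pair !eqxx orbT in np.
Qed.

Lemma hub_star v : v != y -> hub f z v = f z v.
Proof.
move=> /negPf vy; have [_ _ _ /negPf zx] := kf; have /negPf zy := kstate_zy kf.
by rewrite /hub /upd /same_pair vy zx zy !andbF.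
Qed.

Lemma hub_branch t u : miss f y t -> branch f t u -> connect (arr (hub f) z) y u.
Proof.
move=> mt bu; apply: (branch_sub_fan kf _ _ _ bu) => [v vy _|v e vx _|r fr _ ry].
- exact: hub_star.
- exact: hub_miss.
apply: connect1; apply/arrP; exists t; last by rewrite hub_star.
by apply: hub_miss => //; have [[_ xy _] _ _ _] := kf; rewrite eq_sym.
Qed.

Lemma hub_link t u c : miss f y t -> branch f t u -> miss f u c ->
  link (hub f) d c z u.
Proof.
move=> mt bu mu; have [ux _ _] := branch_neq kf bu.
by apply: (fan_link hub_partial (hub_branch mt bu) hub_missz); apply: hub_miss.
Qed.

Lemma hub_disjoint t u c : miss f y t -> branch f t u -> miss f u c -> miss f z c -> False.
Proof.
move=> mt bu mu mz; have [ux _ _] := branch_neq kf bu.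
have [_ _ _ zx] := kf.
exact: (fan_disjoint hub_partial (hub_branch mt bu) (hub_miss zx mz) (hub_miss ux mu)).
Qed.

Lemma hub_nodelta t u : miss f y t -> branch f t u -> miss f u d -> False.
Proof.
move=> mt bu mu; have [ux _ _] := branch_neq kf bu.
exact: (fan_disjoint hub_partial (hub_branch mt bu) hub_missz (hub_miss ux mu)).
Qed.

Lemma hub_elementary t t' u v c : miss f y t -> miss f y t' -> branch f t u ->
  branch f t' v -> u != v -> miss f u c -> miss f v c -> False.
Proof.
move=> mt mt' bu bv nuv mu mv.
have [ux _ _] := branch_neq kf bu; have [vx _ _] := branch_neq kf bv.
exact: (fan_elementary hub_partial (hub_branch mt bu) (hub_branch mt' bv) nuv
  hub_missz (hub_miss ux mu) (hub_miss vx mv)).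
Qed.

Lemma hub_elementary_y t u c : miss f y t -> branch f t u ->
  miss f u c -> miss f y c -> False.
Proof.
move=> mt bu mu my; have [ux uy _] := branch_neq kf bu.
have [[_ xy _] _ _ _] := kf.
apply: (fan_elementary hub_partial (hub_branch mt bu) (connect0 _ _) uy hub_missz
  (hub_miss ux mu)).
by apply: hub_miss; rewrite 1?eq_sym.
Qed.

End Hub.

(* For the case that the (s, t)-chain from x to y passes through z: s and t are
   exchanged on the part of the chain from x up to a neighbor w of z, xy is
   colored with t and zw becomes the uncolored edge. At z one of s, t is now
   missing and the other is missing at w, so that the branches of s and t
   together form a single Vizing fan. *)
Record spoke f s t h w c1 c2 : Prop := Spoke {
  sp_partial : partial h z w;
  sp_pair : (c1 = s /\ c2 = t) \/ (c1 = t /\ c2 = s);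
  sp_root : f z w = Some c1;
  sp_missz : miss h z c1;
  sp_missw : miss h w c2;
  sp_xy : h x y = Some t;
  sp_star : forall v, v != w -> h z v = f z v;
  sp_miss : forall u c, u != x -> u != y -> miss f u c -> miss h u c;
  sp_missx : forall c, c != s -> miss f x c -> miss h x c;
  sp_end : w != x -> ~~ miss f w c2 }.

(** The initial part [Q] of the chain has the ends [x] and [w], so it contains neither [y] nor
    another neighbor of [z] along the chain. Once [zw] is uncolored, exchanging on [Q] is proper and
    makes [x] miss [t], as [y] does. *)
Lemma spoke_exists f s t : kstate f -> miss f x s -> miss f y t ->
  link f s t x z -> s != d -> exists h w c1 c2, spoke f s t h w c1 c2.
Proof.
move=> kf ms mt lxz sd; have [pfxy fyz mxd zx] := kf; have [pf xy hf] := pfxy.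
have zy := kstate_zy kf; have fzy := kstate_zyd kf.
have st : s != t by apply/eqP=> e; apply: (kstate_disj kf ms); rewrite e.
have td : t != d.
  by apply: contraTneq mt => ->; apply/missPn; exists z.
have mxt : ~~ miss f x t by apply/negP=> m; apply: (kstate_disj kf m mt).
(* Cutting [z] out of the (s, t)-subgraph makes [Q] below the part of the chain from [x] that
   precedes [z]. *)
pose f0 u v := if ((u == z) || (v == z)) && ab f s t u v then None else f u v.
have pf0 : proper f0.
  split=> [u v|u|u v w c]; rewrite /f0.
  - by rewrite orbC (ab_sym s t pf) (col_sym pf).
  - by rewrite (col_irr pf); case: ifP.
  - by do 2!case: ifP => // _; apply: (col_inj pf).
have f0m u c : miss f u c -> miss f0 u c.
  by move/missP=> m; apply/missP=> v; rewrite /f0; case: ifP.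
have f0ab u v : ab f0 s t u v -> [/\ u != z, v != z & ab f s t u v].
  rewrite {1}/ab /= /f0; case: ifP => // h1 h2; have abuv : ab f s t u v by [].
  by move/negbT: h1; rewrite abuv andbT negb_or => /andP[].
have abf0 u v : u != z -> v != z -> ab f s t u v -> ab f0 s t u v.
  by move=> /negPf uz /negPf vz; rewrite /ab /= /f0 uz vz.
have nbr_end w : ab f s t z w -> endp f0 s t w.
  have aux c : c \in [:: s; t] -> f z w = Some c -> miss f0 w c.
    move=> cst fzw; apply/missP=> v; rewrite /f0; case: ifP => // h fwv.
    rewrite (col_sym pf) in fzw; have vz := col_inj pf fwv fzw.
    move: h; rewrite vz eqxx orbT /ab /= fzw.
    by move: cst; rewrite !inE => /orP[]/eqP->; rewrite eqxx ?orbT.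
  by case/orP=> /eqP/aux m; [apply: endpl|apply: endpr]; apply: m; rewrite !inE eqxx ?orbT.
pose Q := chain f0 s t x.
have xQ : x \in Q by exact: mem_chain.
have zQ u : u \in Q -> u != z.
  rewrite inE => lu; apply: (connect_inv (P := fun u => u != z) _ lu); last by rewrite eq_sym.
  by move=> u' v _ /f0ab[].
(* If no vertex of [Q] led to [z], the chain from [x] would never arrive there. *)
have [w [wQ abw wx]] : exists w, [/\ w \in Q, ab f s t z w & f z x = Some t -> w = x].
  case: (eqVneq (f z x) (Some t)) => [fzx|nzx].
    by exists x; split=> //; rewrite /ab /= fzx eqxx orbT.
  have [/existsP[w /andP[wQ abw]]|/existsPn none] :=
    boolP [exists w, (w \in Q) && ab f s t z w].
    by exists w; split=> // e; rewrite e eqxx in nzx.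
  suff /zQ : z \in Q by rewrite eqxx.
  apply: (connect_inv (P := fun u => u \in Q) _ lxz) => // u v uQ uv.
  have [vz|vz] := eqVneq v z.
    by have := none u; rewrite uQ (ab_sym s t pf) -vz uv.
  by apply: (chain_closed uQ); apply: abf0 => //; apply: zQ.
have Qx : f z x = Some t -> forall u, u \in Q -> u = x.
  move=> fzx u; rewrite inE => lu; apply: (connect_inv (P := fun u => u = x) _ lu) => //.
  move=> u' v -> /f0ab[_ vz] /orP[]/eqP fxv; first by case: (missE ms fxv).
  rewrite (col_sym pf) in fzx; by rewrite (col_inj pf fxv fzx) eqxx in vz.
have wx' : w != x -> f z x != Some t by exact: contra_neq.
(* For [w != x], the vertices [x] and [w] are already the two ends of [Q] in [f0]. *)
have Qend u : u \in Q -> w != x -> u != x -> u != w -> ~~ endp f0 s t u.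
  move=> uQ nwx nux nuw; apply/negP=> eu.
  apply: (@ends3 f0 s t x w u) => //; rewrite 1?eq_sym //.
  - by apply: endpl; apply: f0m.
  - exact: nbr_end.
  - by move: wQ; rewrite inE.
  - by move: uQ; rewrite inE.
have zx_t : ab f s t z x -> f z x = Some t.
  by case/orP=> /eqP // fzx; rewrite (col_sym pf) in fzx; case: (missE ms fzx).
have uniqw v : ab f s t z v -> v != w -> v \notin Q.
  move=> abv vw; apply/negP=> vQ; have [wx0|nwx] := eqVneq w x.
    by move: vw; rewrite wx0 (Qx _ _ vQ) ?eqxx //; apply: zx_t; rewrite -wx0.
  have nvx : v != x.
    by apply: contraNneq (wx' nwx) => vx; rewrite zx_t // -vx.
  by have := Qend _ vQ nwx nvx vw; rewrite nbr_end.
have wy : w != y.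
  by apply: contraTneq abw => ->; rewrite /ab /= fzy !(inj_eq Some_inj) 2!(eq_sym d) (negPf sd) (negPf td).
have yQ : y \notin Q.
  apply/negP=> yQ; have [wx0|nwx] := eqVneq w x.
    by move: xy; rewrite (Qx _ _ yQ) ?eqxx //; apply: zx_t; rewrite -wx0.
  have := Qend _ yQ nwx; rewrite [y == x]eq_sym [y == w]eq_sym xy wy => /(_ isT isT).
  by rewrite endpr //; apply: f0m.
have zNQ : z \notin Q by apply/negP=> /zQ; rewrite eqxx.
pose f1 := upd f z w None.
have pf1 : proper f1 by exact: upd_proper_None.
have f1m u c : miss f u c -> miss f1 u c by exact: miss_updN.
have f1s v : v != w -> f1 z v = f z v.
  move=> /negPf vw; rewrite /f1 /upd /same_pair vw andbF /=.
  by case: andP => // -[/eqP zw /eqP vz]; rewrite -zw vz eqxx in vw.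
(* The only chain edge leaving [Q] is [zw], which [f1] uncolors. *)
have cl1 : closed_in f1 s t Q.
  move=> u v uQ; have uz := zQ _ uQ; have [->|vz] := eqVneq v z.
    have [->|uw] := eqVneq u w; first by rewrite /ab /= /f1 /upd /same_pair !eqxx orbT.
    rewrite (ab_sym s t pf1) /ab /= f1s // -/(ab f s t z u) => abu.
    by have := uniqw _ abu uw; rewrite uQ.
  rewrite /ab /= /f1 /upd /same_pair (negPf uz) (negPf vz) andbF /= => uv.
  by apply: (chain_closed uQ); apply: abf0.
pose h0 := kem f1 s t Q; pose h := upd h0 x y (Some t).
have ph0 : proper h0 by exact: kem_proper.
have h0x : miss h0 x t by rewrite miss_kem xQ sw_r; apply: f1m.
have h0y : miss h0 y t by rewrite miss_kem (negPf yQ); apply: f1m.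
have [c1 fzw c1st] : exists2 c1, f z w = Some c1 & c1 = s \/ c1 = t.
  by case/orP: abw => /eqP ->; [exists s; auto|exists t; auto].
have [c2 c12] : exists c2, (c1 = s /\ c2 = t) \/ (c1 = t /\ c2 = s).
  by case: c1st => ->; [exists t; left|exists s; right].
have zw : z != w by rewrite eq_sym zQ.
have zh v : h z v = h0 z v.
  by rewrite /h /upd /same_pair (negPf zx) (negPf zy).
(* Otherwise [w] would be a third end, besides [x] and [y], of the chain in [f]. *)
have wend : w != x -> ~~ miss f w c2.
  move=> nwx; apply/negP=> mw.
  apply: (@ends3 f s t x y w) => //; rewrite 1?eq_sym //.
  - exact: endpl.
  - exact: endpr.
  - by case: c12 => -[_ e]; rewrite e in mw; [apply: endpr|apply: endpl].
  - exact: kstate_link.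
  - exact: connect_trans lxz (connect1 abw).
exists h, w, c1, c2; split=> //.
- split=> //; first exact: upd_proper_Some.
  move=> u v guv; rewrite /h /upd; case: ifP => // np /eqP; rewrite kem_None.
  by rewrite /f1 /upd; case: ifP => // _ /eqP/(hf _ _ guv); rewrite np.
- apply/missP=> v; rewrite zh /h0 /kem (negPf zNQ).
  have [->|vw] := eqVneq v w; first by rewrite /f1 /upd /same_pair !eqxx.
  by rewrite f1s // => fzv; rewrite (col_inj pf fzv fzw) eqxx in vw.
- have m0 : miss h0 w c2.
    rewrite miss_kem wQ; have -> : sw s t c2 = c1 by case: c12 => -[-> ->]; rewrite ?sw_l ?sw_r.
    apply/missP=> v; rewrite /f1 /upd; case: ifP => // np fwv.
    rewrite (col_sym pf) in fzw; by rewrite (col_inj pf fwv fzw) /same_pair !eqxx orbT in np.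
  have [wx0|nwx] := eqVneq w x; last by rewrite miss_upd_out.
  (* If [w = x], then [zw] has color [t], as [s] is missing at [x]; so coloring [xy] with [t] leaves
     [c2] missing. *)
  have ct : c2 = s.
    case: c12 => -[e1 e2] //; move: fzw; rewrite wx0 e1 (col_sym pf) => fxz.
    by case: (missE ms fxz).
  apply/missP=> v; rewrite /h /upd; case: ifP => [_ [tc]|_]; last by move/missP: m0; apply.
  by move: st; rewrite -ct -tc eqxx.
- by rewrite /h /upd /same_pair !eqxx.
- by move=> v vw; rewrite zh /h0 /kem (negPf zNQ) f1s.
- move=> u c ux uy mu; rewrite miss_upd_out // miss_kem.
  case: ifP => uQ; last exact: f1m.
  suff nst : (c != s) && (c != t) by case/andP: nst => ? ?; rewrite sw_id //; apply: f1m.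
  rewrite -negb_or; apply/negP=> cst.
  have nwx : w != x.
    apply: contraNneq ux => wx0; apply/eqP; apply: (Qx _ _ uQ); apply: zx_t; by rewrite -wx0.
  have [uw|uw] := eqVneq u w.
    have cc : c = c2.
      subst u; have cc1 : c != c1.
        by apply: contraTneq mu => ->; apply/missPn; exists z; rewrite (col_sym pf).
      by case: c12 cc1 => -[-> ->] /negPf nc; move: cst; rewrite nc ?orbF => /eqP.
    by have := wend nwx; rewrite -uw -cc mu.
  have := Qend _ uQ nwx ux uw; case/orP: cst => /eqP cc; rewrite cc in mu.
    by rewrite endpl //; apply: f0m.
  by rewrite endpr //; apply: f0m.
- move=> c cs mx; have ct : c != t.
    by apply: contraTneq mx => ->.
  have m0 : miss h0 x c by rewrite miss_kem xQ sw_id //; apply: f1m.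
  apply/missP=> v; rewrite /h /upd; case: ifP => [_ [tc]|_]; last by move/missP: m0; apply.
  by rewrite tc eqxx in ct.
Qed.

Lemma branch_delta f u : kstate f -> branch f d u -> False.
Proof.
move=> kf; have [[pf _ _] _ _ _] := kf; elim=> // r fr _ /eqP; apply.
exact: col_inj fr (kstate_zyd kf).
Qed.

Lemma kstate_neqd f t : kstate f -> miss f y t -> t != d.
Proof. by move=> [_ fyz _ _]; apply: contraTneq => ->; apply/missPn; exists z. Qed.

Lemma kstate_neq f s t : kstate f -> miss f x s -> miss f y t -> s != t.
Proof. by move=> kf ms; apply: contraTneq => <-; apply/negP; apply: kstate_disj. Qed.

Lemma miss_kem_other f a b Q u c : c != a -> c != b ->
  miss (kem f a b Q) u c = miss f u c.
Proof. by move=> ca cb; rewrite miss_kem sw_id // if_same. Qed.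

(** * The single fan formed by the branches of [s] and [t] *)

Section Spoke.
Variables (f h : T -> T -> option C) (s t c1 c2 : C) (w : T).
Hypotheses (kf : kstate f) (sp : spoke f s t h w c1 c2).

(** The root of color [c1] is [w] itself; [c2] is missing at [w], which gives an arrow from [w] to
    the root of the other branch. *)
Lemma spoke_branch c u : c = s \/ c = t -> branch f c u -> connect (arr h z) w u.
Proof.
move=> cst bu; have [[pf _ _] _ _ _] := kf.
apply: (branch_sub_fan kf _ _ _ bu) => [v _|v e|r fr _ _]; first exact: (sp_star sp).
  exact: (sp_miss sp).
have [->|rw] := eqVneq r w; first exact: connect0.
have cc2 : c = c2.
  have nc1 : c != c1.
    apply: contraNneq rw => cc1; rewrite cc1 in fr.
    by rewrite (col_inj pf fr (sp_root sp)).
  by case: cst (sp_pair sp) nc1 => -> [] [-> ->]; rewrite ?eqxx.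
apply: connect1; apply/arrP; exists c2; first exact: (sp_missw sp).
by rewrite (sp_star sp) // fr cc2.
Qed.

Lemma spoke_elementary c c' u v e : c = s \/ c = t -> c' = s \/ c' = t ->
  branch f c u -> branch f c' v -> u != v -> miss f u e -> miss f v e -> False.
Proof.
move=> cst cst' bu bv nuv mu mv.
have [ux uy _] := branch_neq kf bu; have [vx vy _] := branch_neq kf bv.
exact: (fan_elementary (sp_partial sp) (spoke_branch cst bu) (spoke_branch cst' bv)
  nuv (sp_missz sp) (sp_miss sp ux uy mu) (sp_miss sp vx vy mv)).
Qed.

End Spoke.

(** * Comparing the branches of different colors *)

(** The chain from [x] to [y] is exchanged. Its ends are [x] and [y], so other vertices keep their
    missing colors; [z] is off it, so all branches survive, and that of [s] now starts from a color
    of [y]. *)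
Lemma rotate_exists f s t : kstate f -> miss f x s -> s != d -> miss f y t ->
  ~~ link f s t x z ->
  exists h, [/\ kstate h, miss h y s /\ miss h x t,
    forall c, c != s -> miss f x c -> miss h x c,
    forall c u, branch f c u -> branch h c u /\
      (forall e, miss f u e -> miss h u e)
    & (forall u v c, c != s -> c != t -> (h u v == Some c) = (f u v == Some c)) /\
      (forall e, miss f z e -> miss h z e)].
Proof.
move=> kf ms sd mt nl; pose Q := chain f s t x; have [pfxy fyz mxd zx] := kf.
have [pf xy _] := pfxy.
have td := kstate_neqd kf mt; have st := kstate_neq kf ms mt.
have lxy := kstate_link kf ms mt.
have xQ : x \in Q by exact: mem_chain.
have yQ : y \in Q by rewrite inE.
have zQ : z \notin Q by rewrite inE.
have hm u e : u != x -> u != y -> miss f u e -> miss (kem f s t Q) u e.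
  move=> ux uy mu; rewrite miss_kem; case: ifP => // uQ.
  have aux : ~~ endp f s t u.
    apply/negP=> eu; rewrite inE in uQ.
    by apply: (@ends3 f s t x y u) => //; rewrite 1?eq_sym //; [exact: endpl|exact: endpr].
  rewrite sw_id //; apply: contraNneq aux => e_; rewrite e_ in mu.
    exact: endpl.
  exact: endpr.
exists (kem f s t Q); split.
- split=> //; first by apply: kem_partial => //; exact: chain_closed.
    by rewrite /kem yQ fyz /= sw_id // eq_sym.
  by rewrite miss_kem_other // eq_sym.
- by rewrite !miss_kem xQ yQ sw_l sw_r.
- move=> c cs mc; rewrite miss_kem_other //.
  exact: kstate_neq mc mt.
- move=> c u bu; have bneq v : branch f c v -> forall e, miss f v e -> miss (kem f s t Q) v e.
    by move=> /(branch_neq kf)[vx vy _] e; apply: hm.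
  split; last exact: bneq.
  elim: bu => [r fr rx ry|{}u v e bu IHu mu fv vx vy].
    by apply: branch_root => //; rewrite /kem (negPf zQ).
  apply: (branch_step IHu (bneq _ bu _ mu)) => //.
  by rewrite /kem (negPf zQ).
- split=> [u v c cs ct|e]; first exact: kem_other.
  by rewrite miss_kem (negPf zQ).
Qed.

(* If the (s, t)-chain from x to y misses z, then exchanging s and t along it
   turns either branch into a fan of a hub without changing the (d, e)-chains,
   so a common missing color e would give three ends of the chain of z. *)
Lemma branches_elementary f s t c c' u v e : kstate f ->
  miss f x s -> s != d -> miss f y t -> c = s \/ c = t -> c' = s \/ c' = t ->
  branch f c u -> branch f c' v -> u != v -> miss f u e -> miss f v e -> False.
Proof.
move=> kf ms sd mt cst cst' bu bv nuv mu mv.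
have [l|nl] := boolP (link f s t x z).
  have [h [w [c1 [c2 sp]]]] := spoke_exists kf ms mt l sd.
  exact: (spoke_elementary kf sp cst cst' bu bv nuv mu mv).
have [h [kh [mys mxt] hmx hb [ho _]]] := rotate_exists kf ms sd mt nl.
have mixed u' v' : branch f s u' -> branch f t v' -> u' != v' ->
    miss f u' e -> miss f v' e -> False.
  move=> bu' bv' nuv' mu' mv'; have [hbu hmu] := hb _ _ bu'.
  have ed : e != d by apply: contraTneq mv' => ->; apply/negP; exact: (hub_nodelta kf mt bv').
  have et : e != t.
    apply: contraTneq mv' => ->; apply/negP => mvt.
    exact: (hub_elementary_y kf mt bv' mvt mt).
  have es : e != s.
    apply/eqP=> es; rewrite es in mu'.
    exact: (hub_elementary_y kh mys hbu (hmu _ mu') mys).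
  have lv := hub_link kf mt bv' mv'.
  have lu : link (hub f) d e z u'.
    (* The link found for [h] transfers to [f]: neither [d] nor [e] is one of the exchanged
       colors. *)
    have := hub_link kh mys hbu (hmu _ mu').
    rewrite /link (eq_connect (e' := ab (hub f) d e)) // => a b.
    have hubE k : k != s -> k != t -> (hub h a b == Some k) = (hub f a b == Some k).
      by move=> ks kt; rewrite /hub /upd; do 2!case: ifP => // _; apply: ho.
    by rewrite /ab /= !hubE // 1?eq_sym //; exact: kstate_neqd mt.
  have [pfh zy _] := hub_partial kf.
  have [ux _ uz] := branch_neq kf bu'; have [vx _ vz] := branch_neq kf bv'.
  apply: (ends3 pfh _ _ nuv' _ _ _ lu lv); rewrite 1?eq_sym //.
  - by apply: endpl; exact: hub_missz.
  - by apply: endpr; exact: hub_miss.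
  - by apply: endpr; exact: hub_miss.
case: cst bu => -> bu; case: cst' bv => -> bv.
- have [hbu hmu] := hb _ _ bu; have [hbv hmv] := hb _ _ bv.
  exact: (hub_elementary kh mys mys hbu hbv nuv (hmu _ mu) (hmv _ mv)).
- exact: mixed bu bv nuv mu mv.
- by apply: mixed bv bu _ mv mu; rewrite eq_sym.
- exact: (hub_elementary kf mt mt bu bv nuv mu mv).
Qed.

(** Otherwise [rotate_exists] makes [s] a color of [y] while [s'] stays at [x], and
    [branches_elementary] excludes the repetition of [e]. *)
Lemma common_link f s s' t u v e : kstate f ->
  miss f x s -> s != d -> miss f x s' -> s' != d -> s != s' -> miss f y t ->
  branch f s u -> branch f s' v -> u != v -> miss f u e -> miss f v e ->
  link f s t x z.
Proof.
move=> kf ms sd ms' sd' ss' mt bu bv nuv mu mv; apply/negPn/negP => nl.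
have [h [kh [mys mxt] hmx hb _]] := rotate_exists kf ms sd mt nl.
have [hbu hmu] := hb _ _ bu; have [hbv hmv] := hb _ _ bv.
have mxs' : miss h x s' by apply: hmx; rewrite // eq_sym.
by apply: (branches_elementary kh mxs' sd' mys _ _ hbu hbv nuv (hmu _ mu) (hmv _ mv)); auto.
Qed.

(** In the spoke fan, one of [s], [t] is missing at the center [z] and the other at the start [w].
    So [v] would repeat [t] from [z] or from [w]; the case [v = w] is excluded by [sp_end]. *)
Lemma unlinked_of_miss f s t v : kstate f -> miss f x s -> s != d -> miss f y t ->
  branch f s v -> miss f v t -> ~~ link f s t x z.
Proof.
move=> kf ms sd mt bv mv; apply/negP=> l.
have [h [w [c1 [c2 sp]]]] := spoke_exists kf ms mt l sd.
have cv := spoke_branch kf sp (or_introl erefl) bv.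
have [vx vy _] := branch_neq kf bv; have mhv := sp_miss sp vx vy mv.
case: (sp_pair sp) => -[e1 e2]; last first.
  by apply: (fan_disjoint (sp_partial sp) cv _ mhv); rewrite -e1; exact: (sp_missz sp).
have [vw|vw] := eqVneq v w.
  have := sp_end sp; rewrite -vw vx e2 mv => /(_ isT); by [].
apply: (fan_elementary (sp_partial sp) cv (connect0 _ _) vw (sp_missz sp) mhv).
by rewrite -e2; exact: (sp_missw sp).
Qed.

(* The hole returns from zy to xy, whose ends then both miss d. *)
Lemma kite_false f a : partial f z y -> f x y = Some a -> z != x -> x != y ->
  miss f z a -> miss f x d -> miss f y d -> False.
Proof.
move=> [pf zy hf] fxy zx xy mz mx my.
pose f1 := upd (upd f x y None) z y (Some a).
have ad : a != d by apply: contraTneq mx => <-; apply/missPn; exists y.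
have pf1 : proper f1.
  apply: upd_proper_Some => //; [exact: upd_proper_None|exact: miss_updN|].
  apply/missP=> v; rewrite /upd; case: ifP => // np fyv.
  rewrite (col_sym pf) in fxy; by rewrite (col_inj pf fyv fxy) /same_pair !eqxx orbT in np.
have hf1 : partial f1 x y.
  split=> // u v guv; rewrite /f1 /upd; case: ifP => // np; case: ifP => // _.
  by move/(hf _ _ guv); rewrite np.
apply: (close_hole hf1 (c := d)).
  by rewrite miss_upd_out //; [apply: miss_updN|rewrite eq_sym].
apply/missP=> v; rewrite /f1 /upd; case: ifP => [_ [e]|_]; first by rewrite e eqxx in ad.
by case: ifP => // _; apply/missP.
Qed.

(** * Reachable vertices missing [d] *)

Lemma fan_move f w u : partial f z w -> connect (arr f z) w u ->
  exists f', [/\ partial f' z u,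
    forall c, miss f z c -> miss f' z c,
    forall a b, a != z -> b != z -> f' a b = f a b,
    forall v c, ~~ connect (arr f z) w v -> v != z -> miss f v c -> miss f' v c
  & forall c, u != w -> f z u = Some c -> miss f' u c].
Proof.
move=> pfw /connectP[p0 p0P ->]; case/shortenP: p0P => p pth up _.
have [f' [h1 h2 h3 h4 [_ h6]]] := fan_shift pfw pth up.
exists f'; split=> // v c nc; apply: h4; apply: contra nc => vp.
case/splitPl: p / vp pth {up h1 h6} => p1 p2 <-; rewrite cat_path => /andP[pth _].
by apply/connectP; exists p1.
Qed.

(** Shifting the hole to [zy] makes [y] miss [d]. Because [v] misses [d], the fan avoids [x], which
    therefore still misses [d], and [kite_false] applies. *)
Lemma fan_kite_false f w a v : partial f z w -> connect (arr f z) w y -> w != y ->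
  connect (arr f z) w v -> v != x -> miss f v d ->
  f x y = Some a -> f z y = Some d -> z != x -> z != y -> x != y ->
  miss f z a -> miss f x d -> False.
Proof.
move=> pfw cy wy cv vx mv fxy fzy zx zy xy mz mx.
have xC : ~~ connect (arr f z) w x.
  by apply/negP=> cx; apply: (fan_elementary pfw cv cx vx mz mv mx).
have [f' [h1 h2 h3 h4 h5]] := fan_move pfw cy.
have xz : x != z by rewrite eq_sym.
apply: (kite_false (f := f') (a := a)) => //; first by rewrite h3 // eq_sym.
- exact: h2.
- exact: h4.
- by apply: h5; rewrite // eq_sym.
Qed.

(** If the chain meets [z], the spoke fan is prepared for [fan_kite_false], where the color of [xy]
    is missing at [z]. This holds at once if [z] misses [t]; if [z] misses [s], two exchanges
    recolor [xy] from [t] to [s]. *)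
Lemma delta_hub_false f s t e v q : kstate f -> miss f x s -> s != d ->
  miss f x e -> e != s -> e != d -> miss f y t ->
  branch f s v -> miss f v d -> branch f t q -> miss f q e -> False.
Proof.
move=> kf ms sd me es ed mt bv mvd bq mqe.
have [l|nl] := boolP (link f s t x z); last first.
  have [h [kh [mys _] _ hb _]] := rotate_exists kf ms sd mt nl.
  have [hbv hmv] := hb _ _ bv; exact: (hub_nodelta kh mys hbv (hmv _ mvd)).
have [h [w [c1 [c2 sp]]]] := spoke_exists kf ms mt l sd.
have [[pf xy _] fyz mxd zx] := kf; have zy := kstate_zy kf.
have fzy := kstate_zyd kf; have td := kstate_neqd kf mt.
have st := kstate_neq kf ms mt; have et := kstate_neq kf me mt.
have [vx vy vz] := branch_neq kf bv; have [qx qy qz] := branch_neq kf bq.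
have pw := sp_partial sp; have mz := sp_missz sp.
have cv := spoke_branch kf sp (or_introl erefl) bv.
have cq := spoke_branch kf sp (or_intror erefl) bq.
have hvd := sp_miss sp vx vy mvd; have hqe := sp_miss sp qx qy mqe.
have wy : y != w.
  apply/eqP=> yw; have := sp_root sp; rewrite -yw fzy => -[dc].
  by case: (sp_pair sp) => -[c1E _]; rewrite -dc in c1E; move: sd td; rewrite -c1E eqxx.
have hzy : h z y = Some d by rewrite (sp_star sp).
have cy : connect (arr h z) w y.
  by apply: connect_trans cv (connect1 _); apply/arrP; exists d.
have hxd : miss h x d by apply: (sp_missx sp) => //; rewrite eq_sym.
have hxe : miss h x e by exact: (sp_missx sp).
have hxy := sp_xy sp.
have yw : w != y by rewrite eq_sym.
case: (sp_pair sp) => -[e1 e2]; last first.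
  by apply: (fan_kite_false pw cy yw cv vx hvd hxy hzy) => //; rewrite -e1.
rewrite {}e1 {}e2 {c1 c2} in mz sp; have mw := sp_missw sp.
have [ph nzw _] := pw.
have de : d != e by rewrite eq_sym.
have ds : d != s by rewrite eq_sym.
have dt : d != t by rewrite eq_sym.
have ts : t != s by rewrite eq_sym.
have te : t != e by rewrite eq_sym.
have zq : z != q by rewrite eq_sym.
have xq : x != q by rewrite eq_sym.
(* The chain of [z] has the ends [z] and [q], so that of [x] avoids them; exchanging it makes [x]
   miss [s]. *)
pose Q := chain h s e x.
have lzq := fan_link pw cq mz hqe.
have zQ : z \notin Q.
  rewrite inE link_sym //; apply/negP=> lzx.
  exact: (ends3 ph zx zq xq (endpl e mz) (endpr s hxe) (endpr s hqe) lzx lzq).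
have qQ : q \notin Q.
  apply: contra zQ; rewrite !inE => lxq; apply: connect_trans lxq _.
  by rewrite -/(link h s e q z) link_sym.
have Qe u : connect (arr h z) w u -> miss h u e -> u \notin Q.
  move=> cu mu; have [->//|uq] := eqVneq u q.
  by case: (fan_elementary pw cu cq uq mz mu hqe).
pose h1 := kem h s e Q.
have pw1 : partial h1 z w by apply: kem_partial => //; exact: chain_closed.
have cy1 : connect (arr h1 z) w y by exact: kem_fan cy.
have cv1 : connect (arr h1 z) w v by exact: kem_fan cv.
have mz1 : miss h1 z s by rewrite miss_kem (negPf zQ).
have mx1 : miss h1 x s by rewrite miss_kem mem_chain sw_l.
have mw1 : miss h1 w t by rewrite miss_kem_other.
have xd1 : miss h1 x d by rewrite miss_kem_other.
have vd1 : miss h1 v d by rewrite miss_kem_other.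
have xy1 : h1 x y = Some t by rewrite /h1 /kem mem_chain hxy /= sw_id.
have zy1 : h1 z y = Some d by rewrite /h1 /kem (negPf zQ).
have [ph1 _ _] := pw1.
have xw : x != w.
  apply/eqP=> xw; apply: (fan_elementary pw1 cv1 _ vx mz1 vd1 xd1).
  by rewrite xw connect0.
(* Likewise the chain of [z] now ends at [w]; exchanging on that of [x] turns the color [t] of [xy]
   into [s]. *)
pose Q2 := chain h1 s t x.
have lzw := fan_link pw1 (connect0 _ _) mz1 mw1.
have zQ2 : z \notin Q2.
  rewrite inE link_sym //; apply/negP=> lzx.
  exact: (ends3 ph1 zx nzw xw (endpl t mz1) (endpl t mx1) (endpr s mw1) lzx lzw).
have wQ2 : w \notin Q2.
  apply: contra zQ2; rewrite !inE => lxw; apply: connect_trans lxw _.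
  by rewrite -/(link h1 s t w z) link_sym.
have Q2t u : connect (arr h1 z) w u -> miss h1 u t -> u \notin Q2.
  move=> cu mu; have [->//|uw] := eqVneq u w.
  by case: (fan_elementary pw1 cu (connect0 _ _) uw mz1 mu mw1).
pose h2 := kem h1 s t Q2.
have pw2 : partial h2 z w by apply: kem_partial => //; exact: chain_closed.
apply: (@fan_kite_false h2 w s v) => //.
- exact: kem_fan cy1.
- exact: kem_fan cv1.
- by rewrite miss_kem_other.
- by rewrite /h2 /kem mem_chain xy1 /= sw_r.
- by rewrite /h2 /kem (negPf zQ2).
- by rewrite miss_kem (negPf zQ2).
- by rewrite miss_kem_other.
Qed.

(** The vertices [v] and [q] must lie on branches of colors of [x]. Rotating with the color of the
    branch of [q] makes that color missing at [y] and [t] missing at [x]; then [v] contradicts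
    [hub_nodelta] if the branches coincide, and [delta_hub_false] applies otherwise. *)
Lemma delta_false f t v q : kstate f -> miss f y t ->
  reach f v -> v != x -> v != y -> miss f v d ->
  reach f q -> q != x -> q != y -> miss f q t -> False.
Proof.
move=> kf mt rv vx vy mvd rq qx qy mqt; have td := kstate_neqd kf mt.
have [vE|vE|[s [ms|my] bv]] := reach_branch kf rv; first by rewrite vE eqxx in vx.
- by rewrite vE eqxx in vy.
- have [qE|qE|[s' [ms'|my'] bq]] := reach_branch kf rq; first by rewrite qE eqxx in qx.
  + by rewrite qE eqxx in qy.
  + have sd : s != d by apply/eqP=> sd; rewrite sd in bv; exact: branch_delta kf bv.
    have sd' : s' != d by apply/eqP=> sd'; rewrite sd' in bq; exact: branch_delta kf bq.
    have nl := unlinked_of_miss kf ms' sd' mt bq mqt.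
    have [h [kh [mys mxt] hmx hb _]] := rotate_exists kf ms' sd' mt nl.
    have [hbv hmv] := hb _ _ bv; have [hbq hmq] := hb _ _ bq.
    have [ss|ss] := eqVneq s s'.
      by rewrite -ss in mys; exact: (hub_nodelta kh mys hbv (hmv _ mvd)).
    have ts : t != s by rewrite eq_sym; exact: kstate_neq ms mt.
    exact: (delta_hub_false kh (hmx _ ss ms) sd mxt ts td mys hbv (hmv _ mvd) hbq (hmq _ mqt)).
  + exact: (hub_elementary_y kf my' bq mqt mt).
- exact: (hub_nodelta kf my bv mvd).
Qed.

(** * Exchanges that keep vertices reachable *)

(** An edge at [z] can only change between [a] and [b], and both are still missing at reachable
    vertices. *)
Lemma kem_reach f a b Q v :
  (forall c, c = a \/ c = b -> exists2 u, reach (kem f a b Q) u & miss (kem f a b Q) u c) ->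
  reach f v -> reach (kem f a b Q) v.
Proof.
move=> hab; elim=> [||{}u {}v e _ IHu mu fv]; [exact: reach_x|exact: reach_y|].
have [eab|] := boolP ((e == a) || (e == b)); last first.
  rewrite negb_or => /andP[ea eb]; apply: reach_step IHu (_ : miss _ _ e) _.
    by rewrite miss_kem_other.
  by apply/eqP; rewrite kem_other // fv.
have [e' e'ab fv'] : exists2 e', e' = a \/ e' = b & kem f a b Q z v = Some e'.
  rewrite /kem fv /=; case: ifP => _; last by exists e => //; case/orP: eab => /eqP; auto.
  exists (sw a b e) => //; case/orP: eab => /eqP->; rewrite ?sw_l ?sw_r; auto.
have [u' ru' mu'] := hab _ e'ab; exact: reach_step ru' mu' fv'.
Qed.

(** [x] and [y] are the ends of one chain, so the chain of [u] avoids both, and [s] and [t] remain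
    available for [kem_reach]. *)
Lemma swap_root f s t u : kstate f -> miss f x s -> miss f y t ->
  u != x -> u != y -> miss f u s || miss f u t ->
  let h := kem f s t (chain f s t u) in
  [/\ kstate h, forall c, miss h x c = miss f x c,
      forall c, miss h y c = miss f y c & forall v, reach f v -> reach h v].
Proof.
move=> kf ms mt ux uy mu h; have [pfxy fyz mxd zx] := kf; have [pf xy _] := pfxy.
have lxy := kstate_link kf ms mt.
have xQ : x \notin chain f s t u.
  rewrite inE link_sym //; apply/negP=> lxu.
  by apply: (ends3 pf xy _ _ (endpl t ms) (endpr s mt) mu lxy lxu); rewrite eq_sym.
have yQ : y \notin chain f s t u.
  apply: contra xQ; rewrite !inE => luy; apply: connect_trans luy _.
  by rewrite -/(link f s t y x) link_sym.
have hx c : miss h x c = miss f x c by rewrite miss_kem (negPf xQ).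
have hy c : miss h y c = miss f y c by rewrite miss_kem (negPf yQ).
split=> //.
  split=> //; first by apply: kem_partial => //; exact: chain_closed.
    by rewrite /h /kem (negPf yQ).
  by rewrite hx.
move=> v; apply: kem_reach => c [] ->.
  by exists x; [exact: reach_x|rewrite hx].
by exists y; [exact: reach_y|rewrite hy].
Qed.

Lemma miss_kem_or f a b Q u : miss f u a ->
  miss (kem f a b Q) u a \/ miss (kem f a b Q) u b.
Proof. by rewrite !miss_kem; case: ifP => _; rewrite ?sw_l ?sw_r; auto. Qed.

(* The branches of u and v avoid the edges at z colored t or e, so u and v stay
   reachable; a vertex that still misses e keeps everything else reachable. *)
Lemma swap_common f e t u v : kstate f -> miss f y t ->
  ~~ miss f x e -> ~~ miss f y e -> reach f u -> reach f v ->
  u != x -> u != y -> v != x -> v != y -> u != v -> miss f u e -> miss f v e ->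
  exists h a b, [/\ kstate h /\ (reach h a /\ reach h b),
    forall c, miss h x c = miss f x c,
    forall c, miss h y c = miss f y c,
    (forall w c, c != e -> c != t -> miss h w c = miss f w c) /\
    (forall w, miss f w e -> miss h w e \/ miss h w t)
  & [/\ a = u /\ b = v \/ a = v /\ b = u, miss h a t
     & miss h b t \/ (miss h b e /\ forall w, reach f w -> reach h w)]].
Proof.
move=> kf mt nxe nye.
(* Since [y] is itself an end, its chain cannot contain both [u] and [v]. *)
wlog nl : u v / ~~ link f e t u y => [W ru rv ux uy vx vy nuv mu mv|].
  have [lu|nlu] := boolP (link f e t u y); last exact: W.
  have [lv|nlv] := boolP (link f e t v y).
    have [[pf _ _] _ _ _] := kf; rewrite link_sym // in lu; rewrite link_sym // in lv.
    by case: (ends3 pf _ _ nuv (endpr e mt) (endpl t mu) (endpl t mv) lu lv);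
      rewrite 1?eq_sym.
  have nvu : v != u by rewrite eq_sym.
  have [h [a [b [h1 h2 h3 h4 [h5 h6 h7]]]]] := W v u nlv rv ru vx vy ux uy nvu mv mu.
  by exists h, a, b; split=> //; split=> //; case: h5; auto.
move=> ru rv ux uy vx vy nuv mu mv; have [pfxy fyz mxd zx] := kf.
have [pf xy _] := pfxy.
have nxt : ~~ miss f x t by apply/negP=> m; exact: kstate_disj kf m mt.
have de : d != e by apply: contraNneq nxe => <-.
have dt : d != t by rewrite eq_sym; exact: kstate_neqd mt.
pose Q := chain f e t u; pose h := kem f e t Q.
have yQ : y \notin Q by rewrite inE.
have hy c : miss h y c = miss f y c by rewrite miss_kem (negPf yQ).
(* Neither [e] nor [t] is missing at [x], so its missing colors are unchanged even if [x] is on the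
   chain. *)
have hx c : miss h x c = miss f x c.
  rewrite miss_kem; case: ifP => // _; have [->|ce] := eqVneq c e.
    by rewrite sw_l (negPf nxt) (negPf nxe).
  have [->|ct] := eqVneq c t; last by rewrite sw_id.
  by rewrite sw_r (negPf nxt) (negPf nxe).
have kh : kstate h.
  split=> //; first by apply: kem_partial => //; exact: chain_closed.
    by rewrite /h /kem (negPf yQ).
  by rewrite hx.
have br a : reach f a -> a != x -> a != y -> exists2 s, miss f x s \/ miss f y s & branch f s a.
  by move=> ra ax ay; case: (reach_branch kf ra) ax ay => [->|->|//]; rewrite eqxx.
have nd s a : branch f s a -> s != d.
  by move=> b_; apply/eqP=> sd; rewrite sd in b_; exact: branch_delta kf b_.
have hubF t' a b : miss f y t' -> branch f t' a -> reach f b -> b != x -> b != y ->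
    a != b -> miss f a e -> miss f b e -> False.
  move=> mt' ba rb bx by_ nab ma mb; have [s ms bb] := br _ rb bx by_.
  case: ms => ms; last exact: (hub_elementary kf mt' ms ba bb nab ma mb).
  by apply: (branches_elementary kf ms (nd _ _ bb) mt' _ _ ba bb nab ma mb); auto.
have stay a b : reach f a -> reach f b -> a != x -> a != y -> b != x -> b != y ->
    a != b -> miss f a e -> miss f b e -> reach h a.
  move=> ra rb ax ay bx by_ nab ma mb; have [s ms ba] := br _ ra ax ay.
  case: ms => ms; last by case: (hubF _ _ _ ms ba rb bx by_ nab ma mb).
  have se : s != e by apply: contraNneq nxe => <-.
  have st : s != t by exact: kstate_neq mt.
  (* The branch can break only at an edge colored [e] or [t]: color [t] leads into the branch of
     [t], and color [e] needs an earlier vertex missing [e]. *)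
  have : [\/ branch h s a, branch f t a
           | exists w, [/\ branch f s w, branch h s w & miss f w e]].
    elim: ba => [r fr rx ry|w v' c bw IH mw fv' v'x v'y].
      by constructor 1; apply: branch_root => //; apply/eqP; rewrite kem_other // fr.
    case: IH => [bhw|btw|ex]; last by constructor 3.
      have [ce|ce] := eqVneq c e; first by constructor 3; exists w; rewrite -ce.
      have [ct|ct] := eqVneq c t.
        by constructor 2; apply: branch_root; rewrite // -ct.
      constructor 1; apply: (branch_step (e := c) bhw) => //.
        by rewrite miss_kem_other.
      by apply/eqP; rewrite kem_other // fv'.
    by constructor 2; apply: branch_step mw fv' _ _.
  have rh : branch h s a -> reach h a by apply: branch_reach; left; rewrite hx.
  case=> [//|bta|[w [bw bhw mw]]]; first by case: (hubF _ _ _ mt bta rb bx by_ nab ma mb).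
  have [<-|aw] := eqVneq w a; last first.
    by case: (branches_elementary kf ms (nd _ _ ba) mt _ _ bw ba aw mw ma); auto.
  by apply: branch_reach bhw; left; rewrite hx.
have ru' : reach h u by exact: (stay u v).
have rv' : reach h v by apply: (stay v u); rewrite // eq_sym.
exists h, u, v; split=> //.
  split=> [w c ce ct|w mw]; first exact: miss_kem_other.
  exact: miss_kem_or.
have mhu : miss h u t by rewrite miss_kem mem_chain sw_r.
split=> //; first by left.
have [mhv|] := miss_kem_or t Q mv; last by left.
right; split=> // w; apply: kem_reach => c [] ->; first by exists v.
by exists y; [exact: reach_y|rewrite hy].
Qed.

(** * Excluding two repetitions *)

(** Both vertices lie on branches of colors of [x]. One common branch contradicts
    [branches_elementary]; for two branches, [common_link] and [unlinked_of_miss] disagree. *)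
Lemma twin_false f t u v : kstate f -> miss f y t -> reach f u -> reach f v ->
  u != x -> u != y -> v != x -> v != y -> u != v -> miss f u t -> miss f v t -> False.
Proof.
move=> kf mt ru rv ux uy vx vy nuv mu mv.
have [e|e|[s [ms|my] bu]] := reach_branch kf ru; rewrite ?e ?eqxx // in ux uy.
  have [e|e|[s' [ms'|my'] bv]] := reach_branch kf rv; rewrite ?e ?eqxx // in vx vy.
    have sd : s != d by apply/eqP=> sd; rewrite sd in bu; exact: branch_delta kf bu.
    have sd' : s' != d by apply/eqP=> sd'; rewrite sd' in bv; exact: branch_delta kf bv.
    have [ss|ss] := eqVneq s s'.
      rewrite -ss in bv.
      by apply: (branches_elementary kf ms sd mt _ _ bu bv nuv mu mv); auto.
    have l := common_link kf ms sd ms' sd' ss mt bu bv nuv mu mv.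
    by have := unlinked_of_miss kf ms sd mt bu mu; rewrite l.
  exact: (hub_elementary_y kf my' bv mv mt).
exact: (hub_elementary_y kf my bu mu mt).
Qed.

Lemma pick_neq (a u v : T) : u != v -> u != a \/ v != a.
Proof. by have [->|] := eqVneq u a; [rewrite eq_sym; right|left]. Qed.

(** Exchanging [d] and [t] at [s] makes [s] miss [d]. The repetition of [e] then supplies a vertex
    missing a color of [y], for [delta_false]. *)
Lemma second_pair_false f t s p q e : kstate f -> miss f y t ->
  reach f s -> s != x -> s != y -> miss f s t ->
  reach f p -> reach f q -> p != q -> miss f p e -> miss f q e -> e != t -> False.
Proof.
move=> kf mt rs sx sy mst rp rq npq mp mq et; have [_ _ mxd _] := kf.
have td := kstate_neqd kf mt; have dt : d != t by rewrite eq_sym.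
have te : t != e by rewrite eq_sym.
have msor : miss f s d || miss f s t by rewrite mst orbT.
have := swap_root kf mxd mt sx sy msor; set h := kem _ _ _ _ => -[kh hx hy hr].
have hsd : miss h s d by rewrite miss_kem mem_chain sw_l.
have hmt : miss h y t by rewrite hy.
have [ed|ed] := eqVneq e d.
  have aux v : reach f v -> miss f v e -> v != x -> False.
    move=> rv mv vx; rewrite ed in mv.
    have vy : v != y.
      by apply: contraTneq mv => ->; apply/negP; apply: kstate_disj.
    exact: (delta_false kf mt rv vx vy mv rs sx sy mst).
  by case: (pick_neq x npq) => ?; [apply: (aux p)|apply: (aux q)].
have hme w : miss h w e = miss f w e by exact: miss_kem_other.
(* If [y] misses [e], then [e] takes the role of [t] in [h]. *)
have [mye|nye] := boolP (miss f y e).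
  have aux v : reach f v -> miss f v e -> v != y -> False.
    move=> rv mv vy; have vx : v != x.
      by apply: contraTneq mv => ->; apply/negP => m; apply: kstate_disj m mye.
    have hye : miss h y e by rewrite hme.
    apply: (delta_false kh hye (hr _ rs) sx sy hsd (hr _ rv) vx vy).
    by rewrite hme.
  by case: (pick_neq y npq) => ?; [apply: (aux p)|apply: (aux q)].
have [mxe|nxe] := boolP (miss f x e).
  have aux v : reach f v -> miss f v e -> v != x -> False.
    move=> rv mv vx; have vy : v != y by apply: contraNneq nye => <-.
    have hxe : miss h x e by rewrite hme.
    have mvor : miss h v e || miss h v t by rewrite hme mv.
    (* A further exchange of [e] and [t] makes [v] miss [t], while [s] still misses [d]. *)
    have := swap_root kh hxe hmt vx vy mvor; set h' := kem _ _ _ _ => -[kh' hx' hy' hr'].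
    have hyt' : miss h' y t by rewrite hy'.
    apply: (delta_false kh' hyt' (hr' _ (hr _ rs)) sx sy _ (hr' _ (hr _ rv)) vx vy).
      by rewrite miss_kem_other // eq_sym.
    by rewrite miss_kem mem_chain sw_r hme.
  by case: (pick_neq x npq) => ?; [apply: (aux p)|apply: (aux q)].
have ne v w : miss f v e -> ~~ miss f w e -> v != w by move=> mv; apply: contraNneq => <-.
have px := ne _ _ mp nxe; have py := ne _ _ mp nye.
have qx := ne _ _ mq nxe; have qy := ne _ _ mq nye.
rewrite -!hme in mp mq nxe nye.
have [h' [a [b [[kh' [ra rb]] hx' hy' [hm' _] [ab_ mat mb]]]]] :=
  swap_common kh hmt nxe nye (hr _ rp) (hr _ rq) px py qx qy npq mp mq.
have hyt' : miss h' y t by rewrite hy'.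
have [ax ay bx by_ nab] : [/\ a != x, a != y, b != x, b != y & a != b].
  by case: ab_ => -[-> ->]; split; rewrite // eq_sym.
case: mb => [mbt|[mbe hr']].
  exact: (twin_false kh' hyt' ra rb ax ay bx by_ nab mat mbt).
apply: (delta_false kh' hyt' (hr' _ (hr _ rs)) sx sy _ ra ax ay mat).
by rewrite hm' // eq_sym.
Qed.

(** The two ways to reach total excess 2 once [p] and [p'] both miss [e]: a third vertex, or a
    second color. *)
Definition second_excess f (p p' : T) (e : C) : Prop :=
  (exists q, [/\ reach f q, q != p, q != p' & miss f q e]) \/
  (exists q q' e', [/\ reach f q /\ reach f q', q != q', e' != e, miss f q e' & miss f q' e']).

Lemma root_excess_false f t p p' e : kstate f -> miss f y t ->
  miss f x e || miss f y e ->
  reach f p -> reach f p' -> p != p' -> miss f p e -> miss f p' e ->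
  second_excess f p p' e -> False.
Proof.
move=> kf mt /orP[mxe|mye] rp rp' npp mp mp' sec; last first.
  have nx v : miss f v e -> v != x.
    by apply: contraTneq => ->; apply/negP => m; apply: kstate_disj m mye.
  wlog py : p p' rp rp' npp mp mp' sec / p != y.
    move=> W; case: (pick_neq y npp) => ?; first exact: (W p p').
    apply: (W p' p) => //; first by rewrite eq_sym.
    by case: sec => [[q [? ? ? ?]]|?]; [left; exists q|right].
  case: sec => [[q [rq qp qp' mq]]|[q [q' [e' [[rq rq'] nqq ee mq mq']]]]]; last first.
    by apply: (second_pair_false kf mye rp (nx _ mp) py mp rq rq' nqq mq mq' ee).
  have [p'y|p'y] := eqVneq p' y.
    have qy : q != y by rewrite -p'y.
    by apply: (twin_false kf mye rq rp (nx _ mq) qy (nx _ mp) py qp mq mp).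
  exact: (twin_false kf mye rp rp' (nx _ mp) py (nx _ mp') p'y npp mp mp').
have ny v : miss f v e -> v != y.
  by apply: contraTneq => ->; apply/negP; apply: kstate_disj.
have et := kstate_neq kf mxe mt; have te : t != e by rewrite eq_sym.
(* Exchanging [e] and [t] at [s] makes [s] miss the color [t] of [y], as [second_pair_false] and
   [twin_false] require. *)
have swap_false s s' : reach f s -> s != x -> miss f s e ->
    (reach f s' /\ (s' != x /\ s' != s) /\ miss f s' e \/
     exists q q' e', [/\ reach f q /\ reach f q', q != q', e' != e /\ e' != t, miss f q e'
                       & miss f q' e']) -> False.
  move=> rs sx ms; have sy := ny _ ms; have msor : miss f s e || miss f s t by rewrite ms.
  have := swap_root kf mxe mt sx sy msor; set h := kem _ _ _ _ => -[kh hx hy hr].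
  have hyt : miss h y t by rewrite hy.
  have hst : miss h s t by rewrite miss_kem mem_chain sw_r.
  case=> [[rs' [[s'x s's] ms']]|[q [q' [e' [[rq rq'] nqq [ee et'] mq mq']]]]].
    have s'y := ny _ ms'; have hxe : miss h x e by rewrite hx.
    have [m|m] := miss_kem_or t (chain f e t s) ms'.
      apply: (second_pair_false kh hyt (hr _ rs) sx sy hst (reach_x h) (hr _ rs') _ hxe m et).
      by rewrite eq_sym.
    exact: (twin_false kh hyt (hr _ rs') (hr _ rs) s'x s'y sx sy s's m hst).
  by apply: (second_pair_false kh hyt (hr _ rs) sx sy hst (hr _ rq) (hr _ rq') nqq _ _ et');
    rewrite miss_kem_other.
wlog px : p p' rp rp' npp mp mp' sec / p != x.
  move=> W; case: (pick_neq x npp) => ?; first exact: (W p p').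
  apply: (W p' p) => //; first by rewrite eq_sym.
  by case: sec => [[q [? ? ? ?]]|?]; [left; exists q|right].
case: sec => [[q [rq qp qp' mq]]|[q [q' [e' [[rq rq'] nqq ee mq mq']]]]].
  have [p'x|p'x] := eqVneq p' x.
    apply: (swap_false p q) => //; left; do !split=> //.
    by rewrite -p'x.
  by apply: (swap_false p p') => //; left; do !split=> //; rewrite eq_sym.
have [e't|e't] := eqVneq e' t.
  have aux v : reach f v -> miss f v e' -> v != y -> False.
    move=> rv mv vy; rewrite e't in mv; have vx : v != x.
      by apply: contraTneq mv => ->; apply/negP => m; apply: kstate_disj m mt.
    exact: (second_pair_false kf mt rv vx vy mv rp rp' npp mp mp' et).
  by case: (pick_neq y nqq) => ?; [apply: (aux q)|apply: (aux q')].
by apply: (swap_false p p) => //; right; exists q, q', e'.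
Qed.

(** If [e] is missing at neither [x] nor [y], [swap_common] turns one of [p], [p'] into a vertex
    missing the color [t] of [y]. *)
Lemma excess_false f t p p' e : kstate f -> miss f y t ->
  reach f p -> reach f p' -> p != p' -> miss f p e -> miss f p' e ->
  second_excess f p p' e -> False.
Proof.
move=> kf mt rp rp' npp mp mp' sec.
have [me|] := boolP (miss f x e || miss f y e).
  exact: (root_excess_false kf mt me rp rp' npp mp mp' sec).
rewrite negb_or => /andP[nxe nye].
have ne v w : miss f v e -> ~~ miss f w e -> v != w by move=> mv; apply: contraNneq => <-.
have px := ne _ _ mp nxe; have py := ne _ _ mp nye.
have p'x := ne _ _ mp' nxe; have p'y := ne _ _ mp' nye.
have et : e != t by apply: contraNneq nye => ->.
have [h [a [b [[kh [ra rb]] hx hy [hm hm'] [ab_ mat mb]]]]] :=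
  swap_common kf mt nxe nye rp rp' px py p'x p'y npp mp mp'.
have hyt : miss h y t by rewrite hy.
have [ax ay bx by_ nab] : [/\ a != x, a != y, b != x, b != y & a != b].
  by case: ab_ => -[-> ->]; split; rewrite // eq_sym.
case: mb => [mbt|[mbe hr]].
  exact: (twin_false kh hyt ra rb ax ay bx by_ nab mat mbt).
case: sec => [[q [rq qp qp' mq]]|[q [q' [e' [[rq rq'] nqq ee mq mq']]]]].
  have qx := ne _ _ mq nxe; have qy := ne _ _ mq nye.
  have [qa qb] : q != a /\ q != b by case: ab_ => -[-> ->].
  have [m|m] := hm' _ mq.
    by apply: (second_pair_false kh hyt ra ax ay mat (hr _ rq) rb qb m mbe et).
  exact: (twin_false kh hyt (hr _ rq) ra qx qy ax ay qa m mat).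
(* If the second color is [t], the two repetitions change roles. *)
have [e't|e't] := eqVneq e' t.
  rewrite e't in ee mq mq'.
  have mye' : miss f x t || miss f y t by rewrite mt orbT.
  apply: (root_excess_false kf mt mye' rq rq' nqq mq mq'); right.
  by exists p, p', e; split.
by apply: (second_pair_false kh hyt ra ax ay mat (hr _ rq) (hr _ rq') nqq _ _ e't);
  rewrite hm.
Qed.

Lemma partial_None f a b : partial f a b -> f a b = None.
Proof.
move=> [pf _ hf]; have [[u v] /= guv fuv] := uncolorable pf.
by have := hf _ _ guv fuv; case/orP=> /andP[/eqP <- /eqP <-]; rewrite // (col_sym pf).
Qed.

(** On a branch, [u] belongs to a fan with center [z], so [fan_disjoint] applies; for [u = y] the
    hub fan starts at [u]. *)
Lemma center_disjoint f t u e : kstate f -> miss f y t -> reach f u ->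
  miss f u e -> miss f z e -> False.
Proof.
move=> kf mt ru mu mz; have [pfxy fyz mxd zx] := kf; have [pf xy hf] := pfxy.
have zy := kstate_zy kf; have ph := hub_partial kf.
have hz : miss (hub f) z e by exact: hub_miss.
have yx : y != x by rewrite eq_sym.
have ed : e != d by apply: contraTneq mz => ->; apply/missPn; exists y; exact: kstate_zyd.
have [uE|uE|[s [ms|my] bu]] := reach_branch kf ru; last first.
- have [ux _ _] := branch_neq kf bu.
  exact: (fan_disjoint ph (hub_branch kf my bu) hz (hub_miss kf ux mu)).
- have sd : s != d by apply/eqP=> sd; rewrite sd in bu; exact: branch_delta kf bu.
  have [ux uy _] := branch_neq kf bu.
  have [l|nl] := boolP (link f s t x z).
    have [h [w [c1 [c2 sp]]]] := spoke_exists kf ms mt l sd.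
    apply: (fan_disjoint (sp_partial sp) (spoke_branch kf sp (or_introl erefl) bu)).
      exact: (sp_miss sp zx zy mz).
    exact: (sp_miss sp ux uy mu).
  have [h [kh [mys _] _ hb [_ hz']]] := rotate_exists kf ms sd mt nl.
  have [hbu hmu] := hb _ _ bu.
  exact: (hub_disjoint kh mys hbu (hmu _ mu) (hz' _ mz)).
- by subst u; exact: (fan_disjoint ph (connect0 _ _) hz (hub_miss kf yx mu)).
(* For [u = x]: [hub] only moves color [d], so the (e, t)-chains of [f] and [hub f] agree, and [x],
   [y], [z] would be three ends of one. *)
subst u; have lzy : link (hub f) e t z y.
  exact: (fan_link ph (connect0 _ _) hz (hub_miss kf yx mt)).
have hubE k a b : k != d -> (hub f a b == Some k) = (f a b == Some k).
  move=> kd; have dk : (Some d == Some k) = false by apply: contraNF kd => /eqP[->].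
  have fxy := partial_None pfxy.
  rewrite /hub /upd; case: ifP => [p|_].
    by case/orP: p => /andP[/eqP-> /eqP->]; rewrite ?[f y x](col_sym pf) fxy dk.
  by case: ifP => // /orP[]/andP[/eqP-> /eqP->]; rewrite ?[f z y](col_sym pf) fyz dk.
have lyz : link f e t y z.
  rewrite link_sym // /link -(eq_connect (e := ab (hub f) e t)) // => a b.
  by rewrite /ab /= !hubE // (kstate_neqd kf mt).
have lyx : link f e t y x by rewrite link_sym //; exact: kstate_link.
apply: (ends3 pf yx _ _ (endpr e mt) (endpl t mu) (endpl t mz) lyx lyz).
  by rewrite eq_sym.
by rewrite eq_sym.
Qed.

End Kempe.

(** * Colorings of graphs *)

Section Translation.
Variable T : finType.
Implicit Types (G H : graph T) (u v w : T) (a b : {set T}).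

Lemma edge_at H a u : a \in edges H -> u \in a -> exists2 v, u != v & a = [set u; v].
Proof.
move=> /(subsetP (edges_wf H)); rewrite inE => /andP[_ /cards2P[v [w [nvw ->]]]].
rewrite !inE => /orP[]/eqP->; first by exists w.
by exists v; rewrite 1?eq_sym 1?setUC.
Qed.

Lemma edge_neq H u v : [set u; v] \in edges H -> u != v.
Proof.
move=> /(subsetP (edges_wf H)); rewrite inE => /andP[_]; rewrite cards2.
by case: (u != v).
Qed.

Lemma set2_inj u v w : [set u; v] = [set u; w] -> u != v -> v = w.
Proof.
move=> e nuv; have: v \in [set u; w] by rewrite -e !inE eqxx orbT.
by rewrite !inE eq_sym (negPf nuv) => /eqP.
Qed.

Lemma set2_same_pair u v x y : u != v -> [set u; v] = [set x; y] -> same_pair x y u v.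
Proof.
move=> nuv e; have: u \in [set x; y] by rewrite -e !inE eqxx.
rewrite /same_pair !inE => /orP[]/eqP ue; rewrite ue in e nuv *.
  by rewrite (set2_inj e nuv) !eqxx.
by rewrite (setUC [set x]) in e; rewrite (set2_inj e nuv) !eqxx orbT.
Qed.

Lemma proper_edge_colorable G k (f : T -> T -> option 'I_k) : proper f ->
  (forall u v, [set u; v] \in edges G -> f u v <> None) -> edge_colorable G k.
Proof.
move=> pf total; pose psi := [ffun a : {set T} =>
  if a \in edges G then
    if [pick p : T * T | a == [set p.1; p.2]] is Some p then f p.1 p.2 else None
  else None].
have psiE u v : [set u; v] \in edges G -> psi [set u; v] = f u v.
  move=> uvG; rewrite ffunE uvG; case: pickP => [[u' v'] /= /eqP e|/(_ (u, v))].
    case/orP: (set2_same_pair (edge_neq uvG) e) => /andP[/eqP-> /eqP->] //.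
    exact: col_sym.
  by rewrite /= eqxx.
apply/set0Pn; exists psi; rewrite inE; apply/andP; split.
  apply/forallP=> a; have [aG|naG] := boolP (a \in edges G); last first.
    by rewrite ffunE (negPf naG).
  have := subsetP (edges_wf G) _ aG; rewrite inE => /andP[_ /cards2P[u [v [_ e]]]].
  rewrite e in aG *; rewrite psiE //; by case: (f u v) (total _ _ aG).
apply/forall_inP=> a aG; apply/forall_inP=> b bG; apply/implyP=> /andP[nab].
case/set0Pn=> w; rewrite inE => /andP[wa wb].
have [u nwu ea] := edge_at aG wa; have [v nwv eb] := edge_at bG wb.
rewrite {}ea {}eb {wa wb} in nab aG bG *; rewrite !psiE //.
apply: contraNneq nab; case fwu: (f w u) => [c|]; last by case: (total _ _ aG).
by move/esym/(col_inj pf fwu)->.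
Qed.

Section Coloring.
Variables (k : nat) (H : graph T) (phi : {ffun {set T} -> option 'I_k}).
Hypothesis phiH : phi \in edge_colorings k H.

Definition pair_coloring u v := phi [set u; v].

Lemma pair_coloring_dom a : isSome (phi a) = (a \in edges H).
Proof. by move: phiH; rewrite inE => /andP[/forallP/(_ a)/eqP]. Qed.

Lemma pair_coloring_proper : proper pair_coloring.
Proof.
have edge_of u v c : phi [set u; v] = Some c -> [set u; v] \in edges H.
  by rewrite -pair_coloring_dom => ->.
split=> [u v|u|u v w c].
- by rewrite /pair_coloring setUC.
- rewrite /pair_coloring; case e: (phi _) => [c|] //.
  by have := edge_neq (edge_of _ _ _ e); rewrite eqxx.
- rewrite /pair_coloring => euv euw.
  have uvH := edge_of _ _ _ euv; have uwH := edge_of _ _ _ euw.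
  apply: set2_inj (edge_neq uvH); apply/eqP/negPn/negP => n.
  move: phiH; rewrite inE => /andP[_ /forall_inP/(_ _ uvH)/forall_inP/(_ _ uwH)].
  rewrite n euv euw eqxx implybF => /negP; apply.
  by apply/set0Pn; exists u; rewrite !inE eqxx.
Qed.

Lemma mem_missing u c : (c \in missing H phi u) = miss pair_coloring u c.
Proof.
rewrite inE; apply/forall_inP/missP => [m v e|m a aH].
  have aH : [set u; v] \in edges H by rewrite -pair_coloring_dom [phi _]e.
  have := m _ aH; rewrite !inE eqxx /= => /eqP; exact.
apply/implyP=> ua; have [v _ ea] := edge_at aH ua.
by apply/eqP; rewrite ea; apply: m.
Qed.

End Coloring.

End Translation.

(** * The bound for the broom *)

Theorem theorem1p1 (T : finType) (G : graph T) (x y : T)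
    (phi : {ffun {set T} -> option 'I_(max_degree G)}) (z : T) (v : seq T) :
  critical G ->
  [set x; y] \in edges G ->
  phi \in edge_colorings (max_degree G) (del_edge G [set x; y]) ->
  short_broom G x y phi z v ->
  \sum_(a < max_degree G)
    excess (del_edge G [set x; y]) phi (broom_vertices x y z v) a <= 1.
Proof.
move=> [chiG _] xyG phiH [szv uniqv _ yzG zvG [d phiyz mxd] color_zv].
set H := del_edge G _ in phiH mxd color_zv *.
pose g : rel T := fun u w => [set u; w] \in edges G.
pose f := pair_coloring phi; have pf : proper f := pair_coloring_proper phiH.
have uncol (h : T -> T -> option 'I_(max_degree G)) : proper h ->
    exists2 e : T * T, g e.1 e.2 & h e.1 e.2 = None.
  move=> ph; have [/existsP[e /andP[ge /eqP he]]|/existsPn none] :=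
    boolP [exists e : T * T, g e.1 e.2 && (h e.1 e.2 == None)]; first by exists e.
  have: edge_colorable G (max_degree G).
    apply: (proper_edge_colorable ph) => u w uwG hN.
    by have := none (u, w); rewrite /= hN eqxx andbT /g uwG.
  move: chiG; rewrite /chromatic_index; case: ex_minnP => m _ min em /min.
  by rewrite em ltnn.
have nxy := edge_neq xyG.
have kf : kstate g x y z d f.
  split=> //; last 2 first.
  - by rewrite -(mem_missing phiH).
  - have /andP[xyzv _] := uniqv; rewrite !inE !negb_or in xyzv.
    by have /and3P[_ xz _] := xyzv; rewrite eq_sym.
  split=> // u w uwG fuw; apply: set2_same_pair; first exact: edge_neq uwG.
  apply/eqP; move: fuw; rewrite /f /pair_coloring => fuw.
  have := pair_coloring_dom phiH [set u; w]; rewrite fuw /H /= !inE [X in _ && X]uwG andbT.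
  by move/esym/negbFE.
(* As [xy] is uncolored, fewer than Delta edges at [y] carry a color. *)
have [t myt] : exists t, miss f y t.
  have [/existsP //|/existsPn full] := boolP [exists t, miss f y t].
  pose E := [set a in edges H | y \in a].
  have yG : y \in vertices G.
    have := subsetP (edges_wf G) _ xyG; rewrite inE powersetE => /andP[/subsetP s _].
    by apply: s; rewrite !inE eqxx orbT.
  have : #|E| < max_degree G.
    apply: leq_trans (_ : degree G y <= _); last exact: (leq_bigmax_cond (F := degree G) y yG).
    rewrite /degree [X in _ < X](cardsD1 [set x; y]) in_set xyG set22 add1n ltnS.
    apply: subset_leq_card; apply/subsetP=> a; rewrite !inE.
    by case/andP=> /andP[-> ->] ->.
  (* With every color present at [y], the image of [E] and [None] exhaust the option type, of size
     Delta + 1. *)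
  have : #|[set: option 'I_(max_degree G)]| <= #|None |: [set phi a | a in E]|.
    apply: subset_leq_card; apply/subsetP=> -[c _|_]; last by rewrite !inE eqxx.
    have /missPn[w fyw] := full c.
    rewrite !inE; apply/imsetP; exists [set y; w]; last exact: esym.
    by rewrite /E in_set set21 andbT -(pair_coloring_dom phiH) [phi _]fyw.
  rewrite cardsT card_option card_ord cardsU1 => le1 lt1.
  have := leq_trans le1 (leq_add (leq_b1 _) (leq_imset_card _ _)).
  by rewrite add1n ltnS leqNgt lt1.
have reachv : {in [:: x, y & v], forall u, reach x y z f u}.
  suff main n : n <= size v -> {in [:: x, y & take n v], forall u, reach x y z f u}.
    by have := main _ (leqnn _); rewrite take_size.
  elim: n => [_ u|n IHn lt_n u].
    by rewrite take0 !inE => /orP[]/eqP->; [exact: reach_x|exact: reach_y].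
  rewrite (take_nth x) // -!rcons_cons mem_rcons inE => /orP[/eqP->|]; last exact: IHn (ltnW lt_n) _.
  have [c phic /bigcupP[w]] := color_zv _ lt_n.
  rewrite inE (mem_missing phiH) => w_in mw.
  apply: (@reach_step _ _ x y z f w _ c) => //.
  (* The color of an edge at [z] is not missing at [z], so [w] is not [z]. *)
  apply: (IHn (ltnW lt_n)); move: w_in; rewrite !inE => /or4P[-> //|->|/eqP wz|->]; rewrite ?orbT //.
  by case: (missE mw (v := nth x v n)); rewrite wz.
pose S a := [set u in broom_vertices x y z v | a \in missing H phi u].
(* Truncated subtraction gives 0 when [S a] is empty. *)
have excessE a : excess H phi (broom_vertices x y z v) a = #|S a| - 1.
  rewrite /excess; case: ifP => // /negbT na; rewrite (_ : S a = set0) ?cards0 //.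
  apply/setP=> u; rewrite in_set0 in_set; apply: contraNF na => /andP[ub ma].
  by apply/bigcupP; exists u.
have inS a u : u \in S a -> miss f u a /\ (u = z \/ reach x y z f u).
  rewrite in_set in_set => /andP[ub]; rewrite (mem_missing phiH) => mu; split=> //.
  move: ub; rewrite !inE => /or4P[] h; [right|right|left; exact/eqP|right];
    by apply: reachv; rewrite !inE h ?orbT.
(* By [center_disjoint], [z] shares no missing color with a reachable vertex. *)
have reachS a u w : u \in S a -> w \in S a -> u != w -> reach x y z f u.
  move=> /inS[mu [uz|//]] /inS[mw [wz|rw]]; first by rewrite uz wz eqxx.
  by rewrite uz in mu; case: (center_disjoint uncol kf myt rw mw mu).
have missS a u : u \in S a -> miss f u a by case/inS.
under eq_bigr => a _ do rewrite excessE.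
(* A third vertex is the first alternative of [second_excess]; a second repeated color, excluded
   afterwards, is the other. *)
have small a : #|S a| <= 2.
  rewrite leqNgt; apply/negP=> /card_gt2P[u [w [q [[uS wS qS] [uw wq qu]]]]].
  apply: (excess_false uncol kf myt (reachS _ _ _ uS wS uw) (reachS _ _ _ wS qS wq) uw
    (missS _ _ uS) (missS _ _ wS)); left; exists q; split=> //.
  - exact: reachS qS uS qu.
  - by rewrite eq_sym.
  - exact: missS qS.
have [a0 big0|none] := pickP (fun a => 1 < #|S a|); last first.
  by rewrite big1 // => a _; apply/eqP; rewrite subn_eq0 leqNgt none.
rewrite (bigD1 a0) //= big1 ?addn0 => [|a na]; first by rewrite leq_subLR.
apply/eqP; rewrite subn_eq0 leqNgt; apply/negP=> big1.
have [u [w [uS wS uw]]] := card_gt1P big0.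
have [q [q' [qS q'S qq]]] := card_gt1P big1.
have wu : w != u by rewrite eq_sym.
have q'q : q' != q by rewrite eq_sym.
apply: (excess_false uncol kf myt (reachS _ _ _ uS wS uw) (reachS _ _ _ wS uS wu) uw
  (missS _ _ uS) (missS _ _ wS)); right; exists q, q', a; split=> //.
- by split; [apply: reachS qS q'S qq|apply: reachS q'S qS q'q].
- exact: missS qS.
- exact: missS q'S.
Qed.
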